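(* Let $g>0$, $\rho_+>\rho_->0$, $[\rho]:=\rho_+-\rho_->0$, $\mu_\pm>0$ and $B\in\mathbb{R}\setminus\{0\}$. For $\xi\in\mathbb{R}$ and $\lambda>0$ consider the problem (horizontal magnetic field) of finding $\psi:[-1,1]\to\mathbb{R}$, whose restrictions to $[-1,0]$ and $[0,1]$ are $C^4$, such that on $(-1,0)\cup(0,1)$ $$-\lambda^2\rho(\xi^2\psi-\psi'')=\mu\lambda(\xi^4\psi-2\xi^2\psi''+\psi'''')+|B|^2(\xi^4\psi-\xi^2\psi''),$$ with the jump conditions $$\llbracket\psi\rrbracket=\llbracket\psi'\rrbracket=0,\qquad \llbracket\mu\lambda(\xi^2\psi+\psi'')\rrbracket=0,\qquad \llbracket\mu\lambda(\psi'''-3\xi^2\psi')\rrbracket=\llbracket\lambda^2\rho\psi'\rrbracket+g[\rho]\xi^2\psi(0),$$ and the boundary conditions $\psi(-1)=\psi(1)=\psi'(-1)=\psi'(1)=0$. Then: (i) if $|B|\ge|B|_c$, then for every $\xi\in\mathbb{R}$ there is no nontrivial solution $\psi$ with $\lambda>0$; (ii) if $|B|<|B|_c$, then for every $\xi\in\mathbb{R}$ with $|\xi|\ge|\xi|_{hc}^B$ there is no nontrivial solution $\psi$ with $\lambda>0$; (iii) if $|B|<|B|_c$, then for every $\xi\in\mathbb{R}$ with $0<|\xi|<|\xi|^B_{hc}$ there exist $\lambda(\xi)>0$ and a solution $\psi=\psi(\xi,x_2)$ of the problem; moreover $\psi$ and $\lambda$ are even in $\xi$, $\psi$ is smooth when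 restricted to $(-1,0)$ or $(0,1)$, and $\psi(\xi,0)\neq0$.
   Context: Here $\rho(x_2)=\rho_+$ and $\mu(x_2)=\mu_+$ for $x_2\in(0,1)$, $\rho(x_2)=\rho_-$ and $\mu(x_2)=\mu_-$ for $x_2\in(-1,0)$; primes denote $d/dx_2$; $\llbracket f\rrbracket:=f(0^+)-f(0^-)$. The critical magnetic number is $|B|_c^2:=\sup\{ g[\rho]\psi(0)^2/\int_{-1}^1|\psi'|^2dx_2 : \psi\in H_0^1((-1,1)),\ \psi\ne0\}$. For $|B|<|B|_c$ the critical frequency is $(|\xi|^B_{hc})^2:=\sup\Big\{\frac{g[\rho]\psi(0)^2-|B|^2\int_{-1}^1|\psi'|^2dx_2}{|B|^2\int_{-1}^1|\psi|^2dx_2}:\ \psi\in H_0^1((-1,1)),\ \psi\neq0\Big\}$. The ODE problem arises from normal modes of the linearized 2D viscous, zero-resistivity MHD Rayleigh–Taylor problem in the slab $\mathbb{R}\times(-1,1)$ with constant horizontal magnetic field $(B,0)$. *)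

(* Defs.v *)
From HB Require Import structures.
From mathcomp Require Import all_boot all_order all_algebra.
From mathcomp Require Import all_classical all_reals all_analysis.
Set Implicit Arguments. Unset Strict Implicit. Unset Printing Implicit Defensive.
Import Order.TTheory GRing.Theory Num.Theory.
Import numFieldNormedType.Exports.
Local Open Scope classical_set_scope.
Local Open Scope ring_scope.

Section Defs.
Variable R : realType.
Local Notation mu := (@lebesgue_measure R).

(** H_0^1((-1,1)) in dimension one: [psi] is the (continuous representative)
    of an H_0^1 function whose weak derivative is [dpsi] : dpsi is in L^2(-1,1),
    psi x = int_{-1}^x dpsi on [-1,1], and psi(1) = 0 (psi(-1) = 0 automatically). *)
Definition H01 (psi dpsi : R -> R) : Prop :=
  measurable_fun `[(-1 : R), 1] dpsi /\
  mu.-integrable `[(-1 : R), 1] (EFin \o dpsi) /\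
  mu.-integrable `[(-1 : R), 1] (fun x => (dpsi x ^+ 2)%:E) /\
  (forall x, -1 <= x <= 1 -> psi x = Rintegral mu `[(-1 : R), x] dpsi) /\
  psi 1 = 0.

Definition nonzero_on (psi : R -> R) : Prop := exists x, -1 < x < 1 /\ psi x != 0.

Definition L2sq (f : R -> R) : R := Rintegral mu `[(-1 : R), 1] (fun x => f x ^+ 2).

(** critical magnetic number squared |B|_c^2 (grho stands for g[rho]) *)
Definition Bc2 (grho : R) : R :=
  sup [set r | exists psi dpsi, H01 psi dpsi /\ nonzero_on psi /\
               r = grho * psi 0 ^+ 2 / L2sq dpsi].
Definition Bc (grho : R) : R := Num.sqrt (Bc2 grho).

Definition xihc2 (grho B : R) : R :=
  sup [set r | exists psi dpsi, H01 psi dpsi /\ nonzero_on psi /\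
               r = (grho * psi 0 ^+ 2 - B ^+ 2 * L2sq dpsi) / (B ^+ 2 * L2sq psi)].
Definition xihc (grho B : R) : R := Num.sqrt (xihc2 grho B).

Definition rlim (f : R -> R) (a : R) : R := lim (f @ at_right a).
Definition llim (f : R -> R) (a : R) : R := lim (f @ at_left a).

(** The restriction of f to [a,b] is C^k: derivatives up to order k exist and are
    continuous on (a,b) and extend continuously to [a,b] (with f itself equal
    to its one-sided limits at a and b). *)
Definition Ck_closed (k : nat) (f : R -> R) (a b : R) : Prop :=
  (forall n, (n < k)%N -> forall x, a < x < b -> derivable (derive1n n f) x 1) /\
  (forall x, a < x < b -> {for x, continuous (derive1n k f)}) /\
  (forall n, (n <= k)%N ->
     cvg (derive1n n f @ at_right a) /\ cvg (derive1n n f @ at_left b)) /\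
  f a = rlim f a /\ f b = llim f b.

Definition smooth_open (f : R -> R) (a b : R) : Prop :=
  forall n, forall x, a < x < b -> derivable (derive1n n f) x 1.

Definition ode_at (rho mu_ B xi lam : R) (psi : R -> R) (x : R) : Prop :=
  let d n := derive1n n psi x in
  - (lam ^+ 2 * rho * (xi ^+ 2 * d 0%N - d 2%N)) =
    mu_ * lam * (xi ^+ 4 * d 0%N - 2 * xi ^+ 2 * d 2%N + d 4%N)
    + B ^+ 2 * (xi ^+ 4 * d 0%N - xi ^+ 2 * d 2%N).

Definition is_solution (g rhop rhom mup mum B xi lam : R) (psi : R -> R) : Prop :=
  let dp n := rlim (derive1n n psi) 0 in
  let dm n := llim (derive1n n psi) 0 in
  Ck_closed 4 psi (-1) 0 /\ Ck_closed 4 psi 0 1 /\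
  (forall x, 0 < x < 1 -> ode_at rhop mup B xi lam psi x) /\
  (forall x, -1 < x < 0 -> ode_at rhom mum B xi lam psi x) /\
  dp 0%N - dm 0%N = 0 /\
  dp 1%N - dm 1%N = 0 /\
  mup * lam * (xi ^+ 2 * dp 0%N + dp 2%N) - mum * lam * (xi ^+ 2 * dm 0%N + dm 2%N) = 0 /\
  mup * lam * (dp 3%N - 3 * xi ^+ 2 * dp 1%N) - mum * lam * (dm 3%N - 3 * xi ^+ 2 * dm 1%N)
    = (lam ^+ 2 * rhop * dp 1%N - lam ^+ 2 * rhom * dm 1%N)
      + g * (rhop - rhom) * xi ^+ 2 * psi 0 /\
  psi (-1) = 0 /\ psi 1 = 0 /\
  rlim (derive1n 1 psi) (-1) = 0 /\ llim (derive1n 1 psi) 1 = 0.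

Definition nontrivial (psi : R -> R) : Prop := exists x, -1 <= x <= 1 /\ psi x != 0.

End Defs.

(* Main.v *)
(* The flux J = lam^2 rho psi psi' + mu lam (4 xi^2 psi psi' - psi psi''' + psi' psi'')
   + B^2 xi^2 psi psi' of a solution is a primitive of a sum of squares, so adding both sides
   of the interface gives the energy identity
     lam^2 int rho (xi^2 psi^2 + psi'^2) + lam int mu ((xi^2 psi + psi'')^2 + 4 xi^2 psi'^2)
       = xi^2 (g[rho] psi(0)^2 - B^2 int (xi^2 psi^2 + psi'^2)).
   Above the critical numbers the right-hand side is nonpositive, which proves (i) and (ii).

   For (iii) no variational argument is needed: the characteristic roots are +-xi and +-s with
   s^2 = xi^2 + (lam^2 rho + B^2 xi^2) / (mu lam), so on each side the solution with
   psi(0) = a, psi'(0) = b and clamped at the wall is explicit. The last two jump conditions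
   become a symmetric 2x2 system M(lam)(a, b) = (g[rho] xi^2 a, 0), which has a solution with
   a = M11 > 0 as soon as det M - g[rho] xi^2 M11 vanishes. This continuous function of lam is
   nonnegative for large lam by the energy identity, and negative for small lam because then
   M00, the top left entry, tends to 2 B^2 xi^3 coth xi, which is below g[rho] xi^2 exactly when
   |xi| is subcritical: int (psi'^2 + xi^2 psi^2) >= 2 xi coth xi psi(0)^2 on H_0^1, by
   comparison with sinh (xi (1 - |x|)). *)

Require Import Defs.
From HB Require Import structures.
From mathcomp Require Import all_boot all_order all_algebra.
From mathcomp Require Import all_classical all_reals all_analysis.
From mathcomp Require Import measurable_realfun ring lra.
Import Order.TTheory GRing.Theory Num.Theory.
Import numFieldNormedType.Exports.
Local Open Scope classical_set_scope.
Local Open Scope ring_scope.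
Set Implicit Arguments. Unset Strict Implicit. Unset Printing Implicit Defensive.

Local Notation leb := lebesgue_measure.
Local Notation itg a b f := (leb.-integrable `[a, b] (EFin \o f)).
Local Notation int a b f := (Rintegral leb `[a, b] f).

(** * Integration on intervals *)

Lemma derivable_continuous (R : realType) (f : R -> R) x :
  derivable f x 1 -> {for x, continuous f}.
Proof. by move=> /derivable1_diffP/differentiable_continuous. Qed.

Lemma integrable_patch d (T : measurableType d) (R : realType)
    (mu : {measure set T -> \bar R}) (A D : set T) (h : T -> R) :
  measurable D -> measurable A -> A `<=` D ->
  mu.-integrable D (EFin \o h) -> mu.-integrable setT (EFin \o (h \_ A)).
Proof.
move=> mD mA AD hi; rewrite -restrict_EFin.
by apply/(integrable_mkcond _ mA).1; exact: integrableS hi.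
Qed.

Lemma integrable_setU d (T : measurableType d) (R : realType)
    (mu : {measure set T -> \bar R}) (A B : set T) (f : T -> \bar R) :
  measurable A -> measurable B -> mu.-integrable A f -> mu.-integrable B f ->
  mu.-integrable (A `|` B) f.
Proof.
move=> mA mB Af Bf; have mBA := measurableD mB mA.
have /integrableP[mf fBA] := integrableS mB mBA (@subDsetl _ _ _) Bf.
have -> : A `|` B = A `|` (B `\` A) by rewrite setUDr setDv setD0.
have /integrableP[mAf fA] := Af.
have mU : measurable_fun (A `|` (B `\` A)) f by apply/measurable_funU => //; split.
apply/integrableP; split => //.
rewrite ge0_integral_setU//.
- exact: lte_add_pinfty.
- exact: measurableT_comp.
- by apply/disj_setPS => x [Ax [_ /(_ Ax)]].
Qed.

Section ProductMeasure.
Context d1 d2 (T1 : measurableType d1) (T2 : measurableType d2) (R : realType).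
Variables (m1 : {sigma_finite_measure set T1 -> \bar R}).
Variables (m2 : {sigma_finite_measure set T2 -> \bar R}).

Lemma integrable_tensor (f : T1 -> R) (g : T2 -> R) :
  m1.-integrable setT (EFin \o f) -> m2.-integrable setT (EFin \o g) ->
  (m1 \x m2)%E.-integrable setT (EFin \o (fun p => f p.1 * g p.2)).
Proof.
move=> fi gi.
have mf : measurable_fun setT f by apply/measurable_EFinP; exact: measurable_int fi.
have mg : measurable_fun setT g by apply/measurable_EFinP; exact: measurable_int gi.
apply/integrable12ltyP.
  by apply/measurable_EFinP; apply: measurable_funM; exact: measurableT_comp.
have norm_fi := integrable_norm fi; have norm_gi := integrable_norm gi.
have gfin := integrable_fin_num measurableT norm_gi.
under eq_integral.
  move=> x _; under eq_integral do rewrite /= normrM EFinM.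
  rewrite integralZl// -(fineK gfin).
  over.
rewrite integralZr//; have ffin := integrable_fin_num measurableT norm_fi.
by rewrite -(fineK ffin) -EFinM ltry.
Qed.

Lemma Rintegral_Fubini (phi : T1 * T2 -> R) :
  (m1 \x m2)%E.-integrable setT (EFin \o phi) ->
  (forall x, m2.-integrable setT (fun y => (phi (x, y))%:E)) ->
  (forall y, m1.-integrable setT (fun x => (phi (x, y))%:E)) ->
  \int[m1]_x \int[m2]_y phi (x, y) = \int[m2]_y \int[m1]_x phi (x, y).
Proof.
move=> phii phiy phix; rewrite /Rintegral.
under eq_integral do rewrite fineK ?integrable_fin_num//.
under [in RHS]eq_integral do rewrite fineK ?integrable_fin_num//.
by rewrite (Fubini phii).
Qed.

End ProductMeasure.

Section IntervalIntegral.
Variable R : realType.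
Implicit Types (a b c d k x y : R) (f g h : R -> R).

Lemma Rintegral_itv_triangle a b f g : itg a b f -> itg a b g ->
  int a b (fun x => g x * int a x f) = int a b (fun y => f y * int y b g).
Proof.
move=> fi gi; set D := `[a, b]%classic.
pose below := [set p : R * R | p.2 <= p.1].
pose phi := (fun p : R * R => (g \_ D) p.1 * (f \_ D) p.2) \_ below.
have belowE x y : ((x, y) \in below) = (y <= x) by apply/idP/idP; rewrite inE.
have phiy x : (fun y => phi (x, y)) = fun y => (g \_ D) x * (f \_ (D `&` `]-oo, x])) y.
  apply/funext => y; rewrite patch_setI /phi !patchE belowE.
  rewrite [mem `]-oo, x]%classic]mem_setE in_itv/=.
  by case: (y <= x); case: (y \in D); rewrite ?mulr0.
have phix y : (fun x => phi (x, y)) = fun x => (f \_ D) y * (g \_ (D `&` `[y, +oo[)) x.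
  apply/funext => x; rewrite patch_setI /phi !patchE belowE.
  rewrite [mem `[y, +oo[%classic]mem_setE in_itv/= andbT.
  by case: (y <= x); case: (x \in D); rewrite ?mulr0 ?mul0r// mulrC.
have slice h (i : interval R) : itg a b h ->
    leb.-integrable setT (EFin \o (h \_ (D `&` [set` i]))).
  move=> hi; apply: integrable_patch hi; [|apply: measurableI|exact: subIsetl];
    exact: measurable_itv.
have slice_f x := slice f `]-oo, x] fi; have slice_g y := slice g `[y, +oo[ gi.
rewrite [LHS]Rintegral_mkcond [RHS]Rintegral_mkcond.
transitivity (\int[leb]_x \int[leb]_y phi (x, y)).
  apply: eq_Rintegral => x _; rewrite phiy RintegralZl// -Rintegral_mkcond !patchE.
  case: ifPn => [|_]; last by rewrite mul0r.
  rewrite mem_setE in_itv/= => /andP[ax xb]; congr (_ * Rintegral _ _ _).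
  by apply/seteqP; split => y; rewrite /D/= !in_itv/=; [split|case=> + +]; lra.
rewrite Rintegral_Fubini.
- apply: eq_Rintegral => y _; rewrite phix RintegralZl// -Rintegral_mkcond !patchE.
  case: ifPn => [|_]; last by rewrite mul0r.
  rewrite mem_setE in_itv/= => /andP[ay yb]; congr (_ * Rintegral _ _ _).
  by apply/seteqP; split => x; rewrite /D/= !in_itv/= andbT; [case=> + +|split]; lra.
- have below_meas : measurable below.
    by rewrite -[below]setTI; apply: measurable_fun_le.
  apply: integrable_patch (integrable_tensor _ _) => //.
    by apply: integrable_patch gi => //; exact: measurable_itv.
  by apply: integrable_patch fi => //; exact: measurable_itv.
- move=> x; have := integrableZl measurableT ((g \_ D) x) (slice_f x).
  by apply: eq_integrable => // y _; rewrite -[phi (x, y)]/((fun y => phi (x, y)) y) phiy.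
- move=> y; have := integrableZl measurableT ((f \_ D) y) (slice_g y).
  by apply: eq_integrable => // x _; rewrite -[phi (x, y)]/((fun x => phi (x, y)) x) phix.
Qed.

Lemma integrable_subitv a b c d f :
  a <= c -> d <= b -> itg a b f -> itg c d f.
Proof.
move=> ac db; apply: integrableS => //.
by apply: subset_itv; rewrite bnd_simp.
Qed.

Lemma Rintegral_itv_cat a c b f : a <= c -> c <= b -> itg a b f ->
  int a b f = int a c f + int c b f.
Proof.
move=> ac cb fi; apply/eqP; rewrite addrC -subr_eq; apply/eqP.
rewrite Rintegral_itvB ?bnd_simp// Rintegral_itv_obnd_cbnd//.
by apply: integrableS fi => //; apply: subset_itv; rewrite bnd_simp.
Qed.

Lemma integrable_itv_cat a c b f : a <= c -> c <= b ->
  itg a c f -> itg c b f -> itg a b f.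
Proof.
move=> ac cb acf cbf.
rewrite (@itv_bndbnd_setU _ _ _ (BRight c)) ?bnd_simp//; apply: integrable_setU => //.
by apply: integrableS cbf => //; apply: subset_itv; rewrite bnd_simp.
Qed.

Lemma integrable_itvD a b f g : itg a b f -> itg a b g ->
  itg a b (fun x => f x + g x).
Proof. by move=> fi gi; apply: eq_integrable (integrableD _ fi gi). Qed.

Lemma integrable_itvZ a b k f : itg a b f -> itg a b (fun x => k * f x).
Proof. by move=> fi; apply: eq_integrable (integrableZl _ k fi). Qed.

Lemma integrable_itv_within a b f : {within `[a, b], continuous f} -> itg a b f.
Proof. by apply: continuous_compact_integrable; exact: segment_compact. Qed.

Lemma eq_oo_integrable_itv a b f g : {in `]a, b[, f =1 g} -> itg a b f -> itg a b g.
Proof.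
move=> fg /integrableP[mf fi].
have oo_cc : `]a, b[ `<=` `[a, b] by apply: subset_itv; rewrite bnd_simp.
have mfoo : measurable_fun `]a, b[ (EFin \o f) by exact: measurable_funS mf.
have mgoo : measurable_fun `]a, b[ (EFin \o g).
  by apply: (eq_measurable_fun (EFin \o f)) => // x; rewrite mem_setE => /fg /= ->.
apply/integrableP; split; first exact: emeasurable_fun_itv_cc mgoo.
rewrite integral_itv_bndoo; last exact: measurableT_comp.
move: fi; rewrite integral_itv_bndoo; last exact: measurableT_comp.
by congr (_ < _)%E; apply: eq_integral => x; rewrite mem_setE => /fg /= ->.
Qed.

Lemma eq_oo_Rintegral_itv a b f g : {in `]a, b[, f =1 g} -> itg a b f ->
  int a b f = int a b g.
Proof.
move=> fg fi; have [mf _] := integrableP _ _ _ fi.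
have [mg _] := integrableP _ _ _ (eq_oo_integrable_itv fg fi).
have oo_cc : `]a, b[ `<=` `[a, b] by apply: subset_itv; rewrite bnd_simp.
congr fine; rewrite integral_itv_bndoo; last exact: measurable_funS mf.
rewrite [RHS]integral_itv_bndoo; last exact: measurable_funS mg.
by apply: eq_integral => x; rewrite mem_setE => /fg ->.
Qed.

End IntervalIntegral.

Section PrimitiveOn.
Variable R : realType.
Implicit Types (a b c d x y : R) (f g F G : R -> R).

Definition primitive_on a b F f : Prop :=
  itg a b f /\ {in `[a, b], forall x, F x = F a + int a x f}.

Lemma primitive_on_increment a b F f : a <= b -> primitive_on a b F f ->
  int a b f = F b - F a.
Proof. by move=> ab [_ ->]; rewrite ?in_itv/= ?ab ?lexx// addrC addKr. Qed.

Lemma primitive_on_subitv a b c d F f : a <= c -> d <= b ->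
  primitive_on a b F f -> primitive_on c d F f.
Proof.
move=> ac db [fi FE]; split; first exact: integrable_subitv fi.
move=> x; rewrite in_itv/= => /andP[cx xd].
have xb := le_trans xd db.
rewrite FE ?in_itv/= ?(le_trans ac)// (FE c) ?in_itv/= ?ac ?(le_trans cx)//.
by rewrite (Rintegral_itv_cat ac cx) ?addrA//; exact: integrable_subitv fi.
Qed.

Lemma primitive_on_cat a c b F f : a <= c -> c <= b ->
  primitive_on a c F f -> primitive_on c b F f -> primitive_on a b F f.
Proof.
move=> ac cb aF cF; have [[fi FE] [gi GE]] := (aF, cF).
have fab := integrable_itv_cat ac cb fi gi; split=> // x; rewrite in_itv/= => /andP[ax xb].
have [xc|/ltW cx] := leP x c; first by apply: FE; rewrite in_itv/= ax.
rewrite GE ?in_itv/= ?cx// (Rintegral_itv_cat ac cx).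
  by rewrite (primitive_on_increment ac aF) addrA [F a + _]addrC subrK.
exact: integrable_subitv fab.
Qed.

Lemma primitive_on_continuous a b F f : a <= b -> primitive_on a b F f ->
  {within `[a, b], continuous F}.
Proof.
move=> ab [fi FE].
apply: (@subspace_eq_continuous _ _ _ (fun x => F a + int a x f)).
  by move=> x; rewrite inE => /FE.
have cP := parameterized_integral_continuous ab fi.
by move=> x; apply: cvgD; [exact: cvg_cst | exact: cP].
Qed.

Lemma integrable_primitive_onM a b F f g : a <= b -> primitive_on a b F f -> itg a b g ->
  itg a b (fun x => g x * F x).
Proof.
move=> ab /(primitive_on_continuous ab) Fc gi.
have : leb.-integrable `[a, b] ((EFin \o g) \* (EFin \o F))%E.
  apply: integrableMl => //.
    by apply: subspace_continuous_measurable_fun.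
  have [M [Mr MP]] : bounded_set (F @` `[a, b]).
    by apply/compact_bounded/continuous_compact => //; exact: segment_compact.
  by exists M; split => // N MN x xab; apply: (MP N MN); exists x.
exact: eq_integrable.
Qed.

Lemma primitive_on_by_parts a b F f G g : a <= b ->
  primitive_on a b F f -> primitive_on a b G g ->
  int a b (fun x => f x * G x) + int a b (fun x => g x * F x) = F b * G b - F a * G a.
Proof.
move=> ab aF aG; have [[fi FE] [gi _]] := (aF, aG).
have Gincr : {in `[a, b], forall y, int y b g = G b - G y}.
  move=> y; rewrite in_itv/= => /andP[ay yb]; apply: primitive_on_increment => //.
  exact: primitive_on_subitv aG.
have lhsE : int a b (fun x => g x * int a x f) =
    int a b (fun x => g x * F x) - F a * int a b g.
  rewrite -RintegralZl// -RintegralB//; last exact: integrable_itvZ.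
    by apply: eq_Rintegral => x; rewrite inE => /FE ->; ring.
  exact: integrable_primitive_onM aF gi.
have rhsE : int a b (fun y => f y * int y b g) =
    G b * int a b f - int a b (fun y => f y * G y).
  rewrite -RintegralZl// -RintegralB//; first last.
  - exact: integrable_primitive_onM aG fi.
  - exact: integrable_itvZ.
  by apply: eq_Rintegral => y; rewrite inE => /Gincr ->; ring.
have := Rintegral_itv_triangle fi gi.
rewrite lhsE rhsE (primitive_on_increment ab aF) (primitive_on_increment ab aG); lra.
Qed.

Definition extend_oo f a b x : R :=
  if x <= a then rlim f a else if x < b then f x else llim f b.

Definition extendable_oo f a b : Prop :=
  [/\ {in `]a, b[, continuous f}, cvg (f x @[x --> a^'+]) & cvg (f x @[x --> b^'-])].

Lemma extend_ooE f a b : {in `]a, b[, extend_oo f a b =1 f}.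
Proof. by move=> x; rewrite in_itv/= => /andP[ax xb]; rewrite /extend_oo leNgt ax xb. Qed.

Lemma extend_oo_left f a b : extend_oo f a b a = rlim f a.
Proof. by rewrite /extend_oo lexx. Qed.

Lemma extend_oo_right f a b : a < b -> extend_oo f a b b = llim f b.
Proof. by move=> ab; rewrite /extend_oo leNgt ab ltxx. Qed.

Lemma near_extend_oo f a b x : x \in `]a, b[ -> {near x, extend_oo f a b =1 f}.
Proof.
by move=> xab; near=> y; apply: extend_ooE; near: y; exact: near_in_itvoo.
Unshelve. all: by end_near. Qed.

Lemma extend_oo_cvg_left f a b : a < b -> cvg (f x @[x --> a^'+]) ->
  extend_oo f a b x @[x --> a^'+] --> extend_oo f a b a.
Proof.
move=> ab fa; rewrite extend_oo_left; apply: cvg_trans fa; apply: near_eq_cvg.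
near=> x; rewrite extend_ooE// in_itv/=; apply/andP; split; near: x.
- exact: nbhs_right_gt.
- exact: nbhs_right_lt.
Unshelve. all: by end_near. Qed.

Lemma extend_oo_cvg_right f a b : a < b -> cvg (f x @[x --> b^'-]) ->
  extend_oo f a b x @[x --> b^'-] --> extend_oo f a b b.
Proof.
move=> ab fb; rewrite extend_oo_right//; apply: cvg_trans fb; apply: near_eq_cvg.
near=> x; rewrite extend_ooE// in_itv/=; apply/andP; split; near: x.
- exact: nbhs_left_gt.
- exact: nbhs_left_lt.
Unshelve. all: by end_near. Qed.

Lemma extend_oo_continuous f a b : a < b -> extendable_oo f a b ->
  {within `[a, b], continuous (extend_oo f a b)}.
Proof.
move=> ab [fc fa fb]; apply/continuous_within_itvP => //; split.
- move=> x xab; rewrite /continuous_at extend_ooE//; apply: cvg_trans (fc x xab).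
  by apply: near_eq_cvg; apply: filterS (near_extend_oo f xab).
- exact: extend_oo_cvg_left.
- exact: extend_oo_cvg_right.
Qed.

Lemma extendable_oo_integrable f a b : a < b -> extendable_oo f a b -> itg a b f.
Proof.
move=> ab fab; apply: (eq_oo_integrable_itv (@extend_ooE f a b)).
exact/integrable_itv_within/extend_oo_continuous.
Qed.

Lemma eq_primitive_on a b F G f g :
  {in `[a, b], F =1 G} -> {in `]a, b[, f =1 g} -> primitive_on a b F f -> primitive_on a b G g.
Proof.
move=> FG fg [fi FE]; split=> [|x xab]; first exact: eq_oo_integrable_itv fg fi.
have /andP[ax xb] : a <= x <= b by []; have ab := le_trans ax xb.
rewrite -!FG ?in_itv/= ?lexx// FE//.
congr (_ + _); apply: eq_oo_Rintegral_itv => [y|]; last exact: integrable_subitv fi.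
by rewrite in_itv/= => /andP[ay yx]; apply: fg; rewrite in_itv/= ay (lt_le_trans yx).
Qed.

Lemma derivable_primitive_on a b F f : derivable_oo_LRcontinuous F a b ->
  {within `[a, b], continuous f} -> {in `]a, b[, derive1 F =1 f} -> primitive_on a b F f.
Proof.
move=> dF fc Ff; split=> [|x]; first exact: integrable_itv_within.
rewrite in_itv/= le_eqVlt => /andP[/predU1P[<- _|ax xb]].
  by rewrite set_itv1 Rintegral_set1 addr0.
have sub_itv : `[a, x] `<=` `[a, b] by apply: subset_itv; rewrite bnd_simp.
have Ff_ax : {in `]a, x[, derive1 F =1 f}.
  by move=> y; rewrite in_itv/= => /andP[ay yx]; apply: Ff; rewrite in_itv/= ay (lt_le_trans yx).
have := continuous_FTC2 ax (continuous_subspaceW sub_itv fc)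
  (derivable_oo_continuousW ax sub_itv dF) Ff_ax.
by rewrite /Rintegral => -> /=; ring.
Qed.

Lemma is_derive_primitive_on a b F f :
  (forall x, is_derive x 1 F (f x)) -> continuous f -> primitive_on a b F f.
Proof.
move=> dF fc.
have Fc : continuous F by move=> x; apply: derivable_continuous.
apply: derivable_primitive_on.
- split=> [x _|//|]; first by [].
  + by apply: cvg_at_right_filter; exact: Fc.
  + by apply: cvg_at_left_filter; exact: Fc.
- exact: continuous_subspaceT.
- by move=> x _; rewrite derive1E derive_val.
Qed.

Lemma extendable_oo_primitive_on F f a b : a < b -> extendable_oo f a b ->
  {in `]a, b[, forall x, is_derive x 1 F (f x)} ->
  cvg (F x @[x --> a^'+]) -> cvg (F x @[x --> b^'-]) ->
  primitive_on a b (extend_oo F a b) f.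
Proof.
move=> ab fab dF Fa Fb.
have : primitive_on a b (extend_oo F a b) (extend_oo f a b).
  apply: derivable_primitive_on (extend_oo_continuous ab fab) _ => //.
  - split; [|exact: extend_oo_cvg_left|exact: extend_oo_cvg_right].
    move=> x xab; have [dFx _] := dF x xab; apply: near_eq_derivable dFx.
    by apply: filterS (near_extend_oo F xab) => y ->.
  - move=> x xab; have dFx := dF x xab.
    by rewrite extend_ooE// derive1E (near_eq_derive _ (near_extend_oo F xab)) derive_val.
exact: eq_primitive_on (@extend_ooE f a b).
Qed.

End PrimitiveOn.

(** * Bounds on [H_0^1] and critical numbers *)

Section Hyperbolic.
Variable R : realType.
Implicit Types x y : R.

Definition cosh x : R := (expR x + expR (- x)) / 2.
Definition sinh x : R := (expR x - expR (- x)) / 2.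

#[global] Instance is_derive_cosh x : is_derive x 1 cosh (sinh x).
Proof. by apply: is_derive_eq; rewrite /sinh /GRing.scale/=; field. Qed.

#[global] Instance is_derive_sinh x : is_derive x 1 sinh (cosh x).
Proof. by apply: is_derive_eq; rewrite /cosh /GRing.scale/=; field. Qed.

Lemma continuous_sinh : continuous sinh.
Proof. by move=> x; apply: derivable_continuous. Qed.

Lemma cosh2_sub_sinh2 x : cosh x ^+ 2 - sinh x ^+ 2 = 1.
Proof.
have expM : expR x * expR (- x) = 1 by rewrite -expRD subrr expR0.
by rewrite /cosh /sinh -[RHS]expM; field.
Qed.

Lemma coshD x y : cosh (x + y) = cosh x * cosh y + sinh x * sinh y.
Proof. by rewrite /cosh /sinh opprD !expRD; field. Qed.

Lemma sinhD x y : sinh (x + y) = sinh x * cosh y + cosh x * sinh y.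
Proof. by rewrite /cosh /sinh opprD !expRD; field. Qed.

Lemma coshN x : cosh (- x) = cosh x.
Proof. by rewrite /cosh opprK addrC. Qed.

Lemma sinhN x : sinh (- x) = - sinh x.
Proof. by rewrite /sinh opprK; field. Qed.

Lemma cosh0 : cosh 0 = 1.
Proof. by rewrite /cosh oppr0 expR0; field. Qed.

Lemma sinh0 : sinh 0 = 0.
Proof. by rewrite /sinh oppr0 subrr mul0r. Qed.

Lemma cosh_gt0 x : 0 < cosh x.
Proof. by rewrite divr_gt0// addr_gt0// expR_gt0. Qed.

Lemma sinh_gt0 x : 0 < x -> 0 < sinh x.
Proof. by move=> x0; rewrite divr_gt0// subr_gt0 ltr_expR; lra. Qed.

Lemma sinh_le_cosh x : sinh x <= cosh x.
Proof. by rewrite /sinh /cosh; have := expR_gt0 (- x); lra. Qed.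

Lemma cosh_le_2sinh x : 1 <= x -> cosh x <= 2 * sinh x.
Proof.
move=> x1; suff : 3 * expR (- x) <= expR x by rewrite /cosh /sinh; lra.
have -> : expR x = expR (x + x) * expR (- x) by rewrite -expRD addrK.
rewrite ler_wpM2r ?expR_ge0//; apply: le_trans (expR_ge1Dx _); lra.
Qed.

Lemma ltr_cosh x y : 0 < x -> x < y -> cosh x < cosh y.
Proof.
move=> x0 xy; pose u := (x + y) / 2; pose v := (y - x) / 2.
have u0 : 0 < u by rewrite /u; lra.
have v0 : 0 < v by rewrite /v; lra.
have -> : x = u + - v by rewrite /u /v; field.
have -> : y = u + v by rewrite /u /v; field.
rewrite !coshD coshN sinhN -subr_gt0.
rewrite (_ : _ - _ = 2 * (sinh u * sinh v)); last by ring.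
by apply: mulr_gt0 => //; apply: mulr_gt0; exact: sinh_gt0.
Qed.

Lemma ltr_sinh_slope x y : 0 < x -> x < y -> y * sinh x < x * sinh y.
Proof.
move=> x0 xy.
have sinh_mvt a b : a < b -> exists2 c, a < c < b & sinh b - sinh a = cosh c * (b - a).
  move=> ab; have [|c cab sinh_ab] := MVT ab (fun z _ => is_derive_sinh z).
    exact: continuous_subspaceT continuous_sinh.
  by exists c.
have [p /andP[p0 px]] := sinh_mvt 0 x x0; rewrite sinh0 !subr0 => sinh_x.
have [q /andP[xq qy] sinh_yx] := sinh_mvt x y xy.
have cosh_pq : cosh p < cosh q by apply: ltr_cosh; rewrite ?(lt_trans px).
rewrite -subr_gt0 (_ : _ - _ = x * (y - x) * (cosh q - cosh p)).
  by rewrite !mulr_gt0// subr_gt0.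
have -> : sinh y = sinh x + cosh q * (y - x) by rewrite -sinh_yx; ring.
by rewrite sinh_x; ring.
Qed.

(* With half sum u and half difference v the claim reads (u sinh v)^2 < (v sinh u)^2. *)
Lemma sinh_cosh_det_gt0 x y : 0 < y -> y < x ->
  0 < 2 - 2 * cosh x * cosh y + (y / x + x / y) * sinh x * sinh y.
Proof.
move=> y0 yx; have x0 := lt_trans y0 yx.
pose u := (x + y) / 2; pose v := (x - y) / 2.
have v0 : 0 < v by rewrite /v; lra.
have vu : v < u by rewrite /u /v; lra.
have slope2 : (u * sinh v) ^+ 2 < (v * sinh u) ^+ 2.
  rewrite ltr_sqr ?nnegrE ?ltr_sinh_slope//.
    by rewrite mulr_ge0 ?ltW ?sinh_gt0// (lt_trans v0).
  by rewrite mulr_ge0 ?ltW ?sinh_gt0// (lt_trans v0).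
have xE : x = u + v by rewrite /u /v; field.
have yE : y = u + - v by rewrite /u /v; field.
have cosh2 z : cosh z ^+ 2 = 1 + sinh z ^+ 2 by have := cosh2_sub_sinh2 z; lra.
have coshM : cosh x * cosh y = cosh u ^+ 2 * cosh v ^+ 2 - sinh u ^+ 2 * sinh v ^+ 2.
  by rewrite xE yE !coshD coshN sinhN; ring.
have sinhM : sinh x * sinh y = sinh u ^+ 2 * cosh v ^+ 2 - cosh u ^+ 2 * sinh v ^+ 2.
  by rewrite xE yE !sinhD coshN sinhN; ring.
rewrite -(pmulr_rgt0 _ (mulr_gt0 x0 y0)).
have -> : x * y * (2 - 2 * cosh x * cosh y + (y / x + x / y) * sinh x * sinh y) =
   x * y * (2 - 2 * (cosh x * cosh y)) + (y ^+ 2 + x ^+ 2) * (sinh x * sinh y).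
  by field; rewrite !gt_eqF.
rewrite coshM sinhM !cosh2 xE yE; clearbody u v.
by rewrite (_ : _ + _ = 4 * ((v * sinh u) ^+ 2 - (u * sinh v) ^+ 2)); [lra|ring].
Qed.

End Hyperbolic.

Section EnergyBound.
Variable R : realType.
Implicit Types (a b c k x z : R) (f g F phi dphi : R -> R).

Lemma Rintegral_sqrB a b c f g :
  itg a b (fun x => f x ^+ 2) -> itg a b (fun x => f x * g x) -> itg a b (fun x => g x ^+ 2) ->
  int a b (fun x => (f x - c * g x) ^+ 2) =
  int a b (fun x => f x ^+ 2) - 2 * c * int a b (fun x => f x * g x)
    + c ^+ 2 * int a b (fun x => g x ^+ 2).
Proof.
move=> f2i fgi g2i; have cfgi := integrable_itvZ (- (2 * c)) fgi.
rewrite -mulNr -!RintegralZl// -!RintegralD//.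
- by apply: eq_Rintegral => x _; ring.
- exact: integrable_itvD.
- exact: integrable_itvZ.
Qed.

(* Equality holds for F = c phi: the difference is the energy of F - c phi. *)
Lemma primitive_on_energy_ge a b c k F f phi dphi : a <= b ->
  primitive_on a b F f -> itg a b (fun x => f x ^+ 2) ->
  (forall x, is_derive x 1 phi (dphi x)) -> (forall x, is_derive x 1 dphi (k ^+ 2 * phi x)) ->
  2 * c * (F b * dphi b - F a * dphi a) - c ^+ 2 * (phi b * dphi b - phi a * dphi a) <=
  int a b (fun x => f x ^+ 2) + k ^+ 2 * int a b (fun x => F x ^+ 2).
Proof.
move=> ab aF f2i dF ddF.
have phic : continuous phi by move=> x; apply: derivable_continuous.
have dphic : continuous dphi by move=> x; apply: derivable_continuous.
have a_phi : primitive_on a b phi dphi by exact: is_derive_primitive_on.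
have a_dphi : primitive_on a b dphi (fun x => k ^+ 2 * phi x).
  by apply: is_derive_primitive_on => // x; apply: cvgM; [exact: cvg_cst|exact: phic].
have Fc := primitive_on_continuous ab aF.
have phiw : {within `[a, b], continuous phi} by exact: continuous_subspaceT.
have dphiw : {within `[a, b], continuous dphi} by exact: continuous_subspaceT.
have prodi (G H : R -> R) : {within `[a, b], continuous G} -> {within `[a, b], continuous H} ->
    itg a b (fun x => G x * H x).
  by move=> Gc Hc; apply: integrable_itv_within => x; apply: cvgM; [exact: Gc|exact: Hc].
have by_parts (G g : R -> R) : primitive_on a b G g ->
    int a b (fun x => g x * dphi x) + k ^+ 2 * int a b (fun x => G x * phi x) =
    G b * dphi b - G a * dphi a.
  move=> aG; rewrite -(primitive_on_by_parts ab aG a_dphi) -RintegralZl//.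
    by congr (_ + _); apply: eq_Rintegral => x _; ring.
  exact: prodi (primitive_on_continuous ab aG) phiw.
have F_parts := by_parts _ _ aF; have phi_parts := by_parts _ _ a_phi.
have sqr_ge0_int (h : R -> R) : 0 <= int a b (fun x => h x ^+ 2).
  by apply: Rintegral_ge0 => x _; exact: sqr_ge0.
have := addr_ge0 (sqr_ge0_int (fun x => f x - c * dphi x))
  (mulr_ge0 (sqr_ge0 k) (sqr_ge0_int (fun x => F x - c * phi x))).
have [fi _] := aF; have fdphii := integrable_primitive_onM ab a_dphi fi.
have F2i := prodi F F Fc Fc; have Fphii := prodi F phi Fc phiw.
have phi2i := prodi _ _ phiw phiw; have dphi2i := prodi _ _ dphiw dphiw.
rewrite !Rintegral_sqrB// -F_parts -phi_parts; lra.
Qed.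

Lemma primitive_on_increment_sqr_le a b F f : a <= b ->
  primitive_on a b F f -> itg a b (fun x => f x ^+ 2) ->
  (F b - F a) ^+ 2 <= (b - a) * int a b (fun x => f x ^+ 2).
Proof.
move=> ab aF f2i; pose c := (F b - F a) / (b - a).
have [eq_ab|ab_neq] := eqVneq a b; first by rewrite -eq_ab !subrr mul0r expr0n.
have ba0 : 0 < b - a by rewrite subr_gt0 lt_neqAle ab_neq.
have d_id x : is_derive x (1 : R) (fun y : R => y) 1 := is_derive_id x 1.
have d_cst (x : R) : is_derive x (1 : R) (fun=> 1 : R) (0 ^+ 2 * x).
  by rewrite expr0n mul0r; exact: is_derive_cst.
have := primitive_on_energy_ge c ab aF f2i d_id d_cst.
rewrite expr0n mul0r addr0 !mulr1 -(ler_pM2l ba0) => /(le_trans _); apply.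
have cE : c * (b - a) = F b - F a by rewrite mulfVK// gt_eqF.
by rewrite -cE; lra.
Qed.

Lemma primitive_on_sinh_energy_ge a b z k F f c : a <= b ->
  primitive_on a b F f -> itg a b (fun x => f x ^+ 2) ->
  2 * c * (k * (F b * cosh (k * (b - z)) - F a * cosh (k * (a - z))))
    - c ^+ 2 * (k * (sinh (k * (b - z)) * cosh (k * (b - z))
                     - sinh (k * (a - z)) * cosh (k * (a - z)))) <=
  int a b (fun x => f x ^+ 2) + k ^+ 2 * int a b (fun x => F x ^+ 2).
Proof.
move=> ab aF f2i.
have d_affine x : is_derive x (1 : R) (fun x => k * (x - z)) k.
  by apply: is_derive_eq; rewrite /GRing.scale/=; ring.
have d_sinh x : is_derive x (1 : R) (fun x => sinh (k * (x - z))) (k * cosh (k * (x - z))).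
  by rewrite mulrC; exact: (is_derive1_comp _ (d_affine x)).
have d_cosh x : is_derive x (1 : R) (fun x => k * cosh (k * (x - z)))
    (k ^+ 2 * sinh (k * (x - z))).
  have d_comp : is_derive x (1 : R) (fun x => cosh (k * (x - z))) (sinh (k * (x - z)) * k).
    exact: (is_derive1_comp _ (d_affine x)).
  by apply: is_derive_eq; rewrite /GRing.scale/=; ring.
by apply: le_trans (primitive_on_energy_ge c ab aF f2i d_sinh d_cosh); lra.
Qed.

End EnergyBound.

Section Sobolev.
Variable R : realType.
Implicit Types (k x : R) (f psi dpsi : R -> R).

Lemma H01P psi dpsi : H01 psi dpsi <->
  [/\ primitive_on (-1) 1 psi dpsi, itg (-1) 1 (fun x => dpsi x ^+ 2), psi (-1) = 0 & psi 1 = 0].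
Proof.
split=> [[_ [di [d2i [psiE psi1]]]]|[[di psiE] d2i psi_1 psi1]].
  have psi_1 : psi (-1) = 0 by rewrite psiE ?set_itv1 ?Rintegral_set1//; lra.
  by split => //; split => // x; rewrite in_itv/= psi_1 add0r => /psiE.
split; first by apply/measurable_EFinP; exact: measurable_int di.
by do 3 (split => //); move=> x x1; rewrite psiE ?psi_1 ?add0r// in_itv.
Qed.

Lemma L2sq_ge0 f : 0 <= L2sq f.
Proof. by apply: Rintegral_ge0 => x _; exact: sqr_ge0. Qed.

Lemma L2sq_gt0 f : (0 < L2sq f) = (L2sq f != 0).
Proof. by rewrite lt0r L2sq_ge0 andbT. Qed.

Lemma L2sq_split f : itg (-1) 1 (fun x => f x ^+ 2) ->
  L2sq f = int (-1) 0 (fun x => f x ^+ 2) + int 0 1 (fun x => f x ^+ 2).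
Proof. by apply: Rintegral_itv_cat; lra. Qed.

Lemma H01_sqr_le psi dpsi x : H01 psi dpsi -> -1 <= x <= 1 -> psi x ^+ 2 <= 2 * L2sq dpsi.
Proof.
move=> /H01P[aF d2i psi_1 _] /andP[x_ge x_le].
have := primitive_on_increment_sqr_le x_ge (primitive_on_subitv (lexx _) x_le aF)
  (integrable_subitv (lexx _) x_le d2i).
rewrite psi_1 subr0 => /le_trans; apply.
rewrite /L2sq (Rintegral_itv_cat x_ge x_le d2i).
have left0 : 0 <= int (-1) x (fun x => dpsi x ^+ 2).
  by apply: Rintegral_ge0 => *; exact: sqr_ge0.
have right0 : 0 <= int x 1 (fun x => dpsi x ^+ 2).
  by apply: Rintegral_ge0 => *; exact: sqr_ge0.
by apply: ler_pM => //; rewrite ?lerDl//; clear -x_ge x_le; lra.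
Qed.

Lemma H01_halves psi dpsi : H01 psi dpsi ->
  [/\ primitive_on (-1) 0 psi dpsi, primitive_on 0 1 psi dpsi,
      itg (-1) 0 (fun x => dpsi x ^+ 2) & itg 0 1 (fun x => dpsi x ^+ 2)].
Proof.
move=> /H01P[aF d2i _ _].
by split; [apply: primitive_on_subitv aF|apply: primitive_on_subitv aF
  |apply: integrable_subitv d2i|apply: integrable_subitv d2i]; lra.
Qed.

Lemma H01_sqr0_le psi dpsi : H01 psi dpsi -> 2 * psi 0 ^+ 2 <= L2sq dpsi.
Proof.
move=> H; have [left right left2i right2i] := H01_halves H.
have /H01P[_ d2i psi_1 psi1] := H; rewrite L2sq_split//.
have := primitive_on_increment_sqr_le (lerN10 R) left left2i.
have := primitive_on_increment_sqr_le ler01 right right2i.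
rewrite psi_1 psi1 !subr0 sub0r sqrrN; lra.
Qed.

Lemma H01_energy_ge psi dpsi k : 0 < k -> H01 psi dpsi ->
  2 * k * cosh k * psi 0 ^+ 2 <= sinh k * (L2sq dpsi + k ^+ 2 * L2sq psi).
Proof.
move=> k0 H; have [left right left2i right2i] := H01_halves H.
have /H01P[aF d2i psi_1 psi1] := H.
have sk0 := sinh_gt0 k0.
have psi2i : itg (-1) 1 (fun x => psi x ^+ 2).
  apply: integrable_itv_within; have n11 : (-1 : R) <= 1 by lra.
  by move=> x; apply: cvgM; apply: (primitive_on_continuous n11 aF).
rewrite !L2sq_split//.
have := primitive_on_sinh_energy_ge (-1) k (psi 0 / sinh k) (lerN10 R) left left2i.
have := primitive_on_sinh_energy_ge 1 k (- (psi 0 / sinh k)) ler01 right right2i.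
have -> : k * (0 - 1) = - k by ring.
have -> : k * (0 - -1) = k by ring.
rewrite psi_1 psi1 !subrr mulr0 coshN sinhN sinh0 cosh0.
move: (int _ _ _) (int _ _ _) (int _ _ _) (int _ _ _) => d_right psi_right d_left psi_left.
set c := psi 0 / sinh k; have cs : psi 0 = c * sinh k by rewrite mulfVK// gt_eqF.
rewrite !cs => right_ge left_ge.
have := ler_wpM2l (ltW sk0) (lerD left_ge right_ge).
lra.
Qed.

Lemma H01_trace_le psi dpsi k : 0 < k -> H01 psi dpsi ->
  2 * k * psi 0 ^+ 2 <= L2sq dpsi + k ^+ 2 * L2sq psi.
Proof.
move=> k0 H; have sk0 := sinh_gt0 k0.
rewrite -(ler_pM2l sk0); apply: le_trans (H01_energy_ge k0 H).
have := ler_wpM2l (mulr_ge0 (ltW k0) (sqr_ge0 (psi 0))) (sinh_le_cosh k).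
lra.
Qed.

End Sobolev.

Section CriticalNumbers.
Variable R : realType.
Implicit Types (grho B xi t z : R) (psi dpsi : R -> R).

Lemma sqrtr_le_norm z t : Num.sqrt z <= `|t| -> z <= t ^+ 2.
Proof.
rewrite -sqrtr_sqr !leNgt; apply: contraNN => tz.
by rewrite ltr_sqrt// (le_lt_trans (sqr_ge0 t)).
Qed.

Lemma le_Bc2 grho psi dpsi : 0 <= grho -> H01 psi dpsi -> nonzero_on psi ->
  grho * psi 0 ^+ 2 / L2sq dpsi <= Bc2 grho.
Proof.
move=> g0 H nz; apply: ub_le_sup; last by exists psi, dpsi.
exists (grho / 2) => _ [p [q [H01_p [_ ->]]]].
have [->|q0] := eqVneq (L2sq q) 0; first by rewrite invr0 mulr0 divr_ge0.
rewrite ler_pdivrMr; last by rewrite L2sq_gt0.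
by have := ler_wpM2l g0 (H01_sqr0_le H01_p); lra.
Qed.

(* The trace inequality with k = grho / (2 B^2). *)
Lemma H01_magnetic_trace_le grho B psi dpsi : 0 < grho -> B != 0 -> H01 psi dpsi ->
  grho * psi 0 ^+ 2 <= B ^+ 2 * L2sq dpsi + (grho / (2 * B ^+ 2)) ^+ 2 * (B ^+ 2 * L2sq psi).
Proof.
move=> g0 B0 H; have B2 : 0 < B ^+ 2 by rewrite exprn_even_gt0.
have k0 : 0 < grho / (2 * B ^+ 2) by rewrite divr_gt0// mulr_gt0.
have := ler_wpM2l (ltW B2) (H01_trace_le k0 H).
set k := grho / _ in k0 *; have -> : grho = 2 * k * B ^+ 2 by rewrite /k; field.
lra.
Qed.

Lemma le_xihc2 grho B psi dpsi : 0 < grho -> B != 0 -> H01 psi dpsi -> nonzero_on psi ->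
  (grho * psi 0 ^+ 2 - B ^+ 2 * L2sq dpsi) / (B ^+ 2 * L2sq psi) <= xihc2 grho B.
Proof.
move=> g0 B0 H nz; apply: ub_le_sup; last by exists psi, dpsi.
exists ((grho / (2 * B ^+ 2)) ^+ 2) => _ [p [q [H01_p [_ ->]]]].
have [->|p0] := eqVneq (L2sq p) 0; first by rewrite mulr0 invr0 mulr0 sqr_ge0.
rewrite ler_pdivrMr; last by rewrite mulr_gt0 ?exprn_even_gt0 ?L2sq_gt0.
by have := H01_magnetic_trace_le g0 B0 H01_p; lra.
Qed.

Lemma nonzero_on_at0 psi : psi 0 != 0 -> nonzero_on psi.
Proof. by exists 0; split=> //; rewrite oppr_lt0 ltr01. Qed.

Lemma Bc_energy_ge grho B psi dpsi : 0 < grho -> Bc grho <= `|B| -> H01 psi dpsi ->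
  grho * psi 0 ^+ 2 <= B ^+ 2 * L2sq dpsi.
Proof.
move=> g0 /sqrtr_le_norm Bc2_le H.
have [->|psi0] := eqVneq (psi 0) 0; first by rewrite expr0n mulr0 mulr_ge0 ?sqr_ge0 ?L2sq_ge0.
have dpsi0 : 0 < L2sq dpsi.
  by apply: lt_le_trans (H01_sqr0_le H); rewrite mulr_gt0// exprn_even_gt0.
rewrite -ler_pdivrMr//; apply: le_trans Bc2_le.
by apply: le_Bc2 => //; [exact: ltW|exact: nonzero_on_at0].
Qed.

Lemma xihc_energy_ge grho B xi psi dpsi : 0 < grho -> B != 0 ->
  xihc grho B <= `|xi| -> H01 psi dpsi ->
  grho * psi 0 ^+ 2 <= B ^+ 2 * (xi ^+ 2 * L2sq psi + L2sq dpsi).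
Proof.
move=> g0 B0 /sqrtr_le_norm xihc2_le H.
have [->|psi0] := eqVneq (psi 0) 0.
  rewrite expr0n mulr0; apply: mulr_ge0 (sqr_ge0 B) (addr_ge0 _ (L2sq_ge0 _)).
  exact: mulr_ge0 (sqr_ge0 xi) (L2sq_ge0 _).
have [psi_0|psi_neq0] := eqVneq (L2sq psi) 0.
  by have := H01_magnetic_trace_le g0 B0 H; rewrite psi_0; lra.
have B2psi : 0 < B ^+ 2 * L2sq psi.
  by rewrite mulr_gt0 ?exprn_even_gt0 ?L2sq_gt0.
have := le_trans (le_xihc2 g0 B0 H (nonzero_on_at0 psi0)) xihc2_le.
by rewrite ler_pdivrMr//; lra.
Qed.

Lemma lt_xihc grho B xi : B != 0 -> 0 < xi -> xi < xihc grho B ->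
  B ^+ 2 * (2 * xi * cosh xi) < grho * sinh xi.
Proof.
move=> B0 xi0; rewrite -[X in X < _](gtr0_norm xi0) ltNge => xi_lt.
have {xi_lt} : xi ^+ 2 < xihc2 grho B.
  by rewrite ltNge; apply: contra xi_lt => /ler_wsqrtr; rewrite sqrtr_sqr.
rewrite /xihc2; set E := (X in sup X) => xi2_lt.
have E0 : E !=set0.
  by apply/set0P; apply: contraTneq xi2_lt => ->; rewrite sup0 -leNgt sqr_ge0.
have [_ [p [q [H01_p [_ ->]]]]] := sup_gt E0 xi2_lt.
have B2 : 0 < B ^+ 2 by rewrite exprn_even_gt0.
have [->|p_neq0] := eqVneq (L2sq p) 0; first by rewrite mulr0 invr0 mulr0 ltNge sqr_ge0.
rewrite ltr_pdivlMr => [quotient_gt|]; last by rewrite mulr_gt0// L2sq_gt0.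
have energy_lt : B ^+ 2 * (L2sq q + xi ^+ 2 * L2sq p) < grho * p 0 ^+ 2 by lra.
have p0_gt0 : 0 < p 0 ^+ 2.
  rewrite lt_neqAle sqr_ge0 andbT; apply: contraTneq energy_lt => <-.
  rewrite mulr0 -leNgt; apply: mulr_ge0 (ltW B2) (addr_ge0 (L2sq_ge0 _) _).
  exact: mulr_ge0 (sqr_ge0 xi) (L2sq_ge0 _).
have energy_ge := ler_wpM2l (ltW B2) (H01_energy_ge xi0 H01_p).
rewrite -(ltr_pM2l (sinh_gt0 xi0)) in energy_lt.
by rewrite -(ltr_pM2r p0_gt0); lra.
Qed.

End CriticalNumbers.

(** * The energy identity *)

Section ClosedPieces.
Variable R : realType.
Implicit Types (a b x : R) (f g : R -> R).

Lemma extendable_oo_cst a b (c : R) : extendable_oo (fun=> c) a b.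
Proof. by split=> [x _||]; [exact: cvg_cst|exact: is_cvg_cst|exact: is_cvg_cst]. Qed.

Lemma extendable_ooD f g a b : extendable_oo f a b -> extendable_oo g a b ->
  extendable_oo (fun x => f x + g x) a b.
Proof.
move=> [fc fa fb] [gc ga gb]; split=> [x xab||].
- by apply: cvgD; [exact: fc|exact: gc].
- exact: cvgP (cvgD fa ga).
- exact: cvgP (cvgD fb gb).
Qed.

Lemma extendable_ooM f g a b : extendable_oo f a b -> extendable_oo g a b ->
  extendable_oo (fun x => f x * g x) a b.
Proof.
move=> [fc fa fb] [gc ga gb]; split=> [x xab||].
- by apply: cvgM; [exact: fc|exact: gc].
- exact: cvgP (cvgM fa ga).
- exact: cvgP (cvgM fb gb).
Qed.

Lemma Ck_closed_extendable_oo k n f a b : Ck_closed k f a b -> (n <= k)%N ->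
  extendable_oo (derive1n n f) a b.
Proof.
move=> [df [fkc [lims _]]] nk; have [fa fb] := lims n nk.
split; [move=> x; rewrite in_itv/= => xab|exact: fa|exact: fb].
move: nk; rewrite leq_eqVlt => /predU1P[->|nk]; first exact: fkc.
exact/derivable_continuous/df.
Qed.

Lemma Ck_closed_is_derive k n f a b x : Ck_closed k f a b -> (n < k)%N -> a < x < b ->
  is_derive x 1 (derive1n n f) (derive1n n.+1 f x).
Proof. by move=> [df _] nk xab; apply: (DeriveDef (df n nk x xab)); rewrite -derive1E. Qed.

Lemma Ck_closed_extend_oo k f a b : a < b -> Ck_closed k f a b ->
  {in `[a, b], extend_oo f a b =1 f}.
Proof.
move=> ab [_ [_ [_ [fa fb]]]] x; rewrite in_itv/= !le_eqVlt => /andP[/predU1P[<- _|ax]].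
  by rewrite extend_oo_left.
by move=> /predU1P[->|xb]; [rewrite extend_oo_right|rewrite extend_ooE// in_itv/= ax].
Qed.

Lemma Ck_closed_primitive_on k f a b : a < b -> Ck_closed k.+1 f a b ->
  primitive_on a b f (derive1 f).
Proof.
move=> ab Cf; have [_ fa fb] := Ck_closed_extendable_oo Cf (leq0n _).
have df_ext := Ck_closed_extendable_oo Cf (ltn0Sn _).
have df : {in `]a, b[, forall x, is_derive x 1 f (derive1 f x)}.
  by move=> x; rewrite in_itv/=; exact: (Ck_closed_is_derive Cf (ltn0Sn _)).
exact: eq_primitive_on (Ck_closed_extend_oo ab Cf) (fun _ _ => erefl)
  (extendable_oo_primitive_on ab df_ext df fa fb).
Qed.

End ClosedPieces.

Section EnergyIdentity.
Variables (R : realType) (rho mu B xi lam : R).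
Implicit Types (a b x r : R) (d : nat -> R) (psi : R -> R).

Definition jet psi x n : R := derive1n n psi x.
Definition right_jet psi x n : R := rlim (derive1n n psi) x.
Definition left_jet psi x n : R := llim (derive1n n psi) x.

Definition jet_ode d : Prop :=
  - (lam ^+ 2 * rho * (xi ^+ 2 * d 0%N - d 2%N)) =
  mu * lam * (xi ^+ 4 * d 0%N - 2 * xi ^+ 2 * d 2%N + d 4%N)
  + B ^+ 2 * (xi ^+ 4 * d 0%N - xi ^+ 2 * d 2%N).

Definition energy_density d : R :=
  lam ^+ 2 * rho * (xi ^+ 2 * (d 0%N * d 0%N) + d 1%N * d 1%N)
  + mu * lam * ((xi ^+ 2 * d 0%N + d 2%N) * (xi ^+ 2 * d 0%N + d 2%N)
                + 4 * xi ^+ 2 * (d 1%N * d 1%N))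
  + B ^+ 2 * xi ^+ 2 * (xi ^+ 2 * (d 0%N * d 0%N) + d 1%N * d 1%N).

Definition tangential_stress d : R := mu * lam * (xi ^+ 2 * d 0%N + d 2%N).

Definition normal_stress d : R :=
  mu * lam * (d 3%N - 3 * xi ^+ 2 * d 1%N) - lam ^+ 2 * rho * d 1%N.

Definition energy_flux d : R :=
  d 1%N * tangential_stress d - d 0%N * normal_stress d + B ^+ 2 * xi ^+ 2 * (d 0%N * d 1%N).

Lemma is_derive_energy_flux psi x :
  (forall n, (n < 4)%N -> is_derive x 1 (derive1n n psi) (jet psi x n.+1)) ->
  ode_at rho mu B xi lam psi x ->
  is_derive x 1 (fun y => energy_flux (jet psi y)) (energy_density (jet psi x)).
Proof.
move=> dpsi; have d0 := dpsi 0%N isT; have d1 := dpsi 1%N isT.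
have d2 := dpsi 2%N isT; have d3 := dpsi 3%N isT.
move: d0 d1 d2 d3; rewrite /ode_at /energy_flux /tangential_stress /normal_stress.
rewrite /energy_density /jet {dpsi}.
move: (derive1n 0 psi) (derive1n 1 psi) (derive1n 2 psi) (derive1n 3 psi) (derive1n 4 psi).
move=> p0 p1 p2 p3 p4 d0 d1 d2 d3 /eqP; rewrite -subr_eq0 => /eqP ode.
apply: is_derive_eq; apply/eqP; rewrite /GRing.scale/= -subr_eq0 -[X in _ == X](mulr0 (p0 x)) -ode.
by apply/eqP; ring.
Qed.

Lemma extendable_oo_energy_density psi a b : Ck_closed 4 psi a b ->
  extendable_oo (fun x => energy_density (jet psi x)) a b.
Proof.
move=> Cpsi; have ext_jet n : (n <= 4)%N -> extendable_oo (fun x => jet psi x n) a b.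
  exact: Ck_closed_extendable_oo Cpsi.
have extZ c f : extendable_oo f a b -> extendable_oo (fun x => c * f x) a b.
  exact: extendable_ooM (extendable_oo_cst a b c).
have [ext0 ext1 ext2] := And3 (ext_jet 0%N isT) (ext_jet 1%N isT) (ext_jet 2%N isT).
have slope2 := extendable_ooM ext1 ext1.
have kinetic := extendable_ooD (extZ (xi ^+ 2) _ (extendable_ooM ext0 ext0)) slope2.
have strain := extendable_ooD (extZ (xi ^+ 2) _ ext0) ext2.
have viscous := extendable_ooD (extendable_ooM strain strain) (extZ (4 * xi ^+ 2) _ slope2).
exact: extendable_ooD (extendable_ooD (extZ _ _ kinetic) (extZ _ _ viscous)) (extZ _ _ kinetic).
Qed.

Lemma cvg_energy_flux (F : set_system R) psi d : Filter F ->
  (forall n, (n <= 3)%N -> jet psi x n @[x --> F] --> d n) ->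
  energy_flux (jet psi x) @[x --> F] --> energy_flux d.
Proof.
move=> FF jet_cvg.
have scale (c : R) (f : R -> R) (l : R) : f x @[x --> F] --> l -> c * f x @[x --> F] --> c * l.
  by move=> fl; apply: cvgM; [exact: cvg_cst|exact: fl].
have tangential_cvg : tangential_stress (jet psi x) @[x --> F] --> tangential_stress d.
  by apply/scale; apply: cvgD; [apply/scale|]; exact: jet_cvg.
have normal_cvg : normal_stress (jet psi x) @[x --> F] --> normal_stress d.
  apply: cvgB; apply/scale; last exact: jet_cvg.
  by apply: cvgB; [|apply/scale]; exact: jet_cvg.
apply: cvgD; first by apply: cvgB; apply: cvgM => //; exact: jet_cvg.
by apply/scale; apply: cvgM; exact: jet_cvg.
Qed.

Lemma energy_identity psi a b : a < b -> Ck_closed 4 psi a b ->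
  (forall x, a < x < b -> ode_at rho mu B xi lam psi x) ->
  int a b (fun x => energy_density (jet psi x)) =
  energy_flux (left_jet psi b) - energy_flux (right_jet psi a).
Proof.
move=> ab Cpsi ode.
have flux_b : energy_flux (jet psi x) @[x --> b^'-] --> energy_flux (left_jet psi b).
  by apply: cvg_energy_flux => n n3; have [_ _] := Ck_closed_extendable_oo Cpsi (leqW n3); exact.
have flux_a : energy_flux (jet psi x) @[x --> a^'+] --> energy_flux (right_jet psi a).
  by apply: cvg_energy_flux => n n3; have [_ + _] := Ck_closed_extendable_oo Cpsi (leqW n3); exact.
have dflux : {in `]a, b[, forall x, is_derive x 1 (fun y => energy_flux (jet psi y))
    (energy_density (jet psi x))}.
  move=> x; rewrite in_itv/= => xab; apply: is_derive_energy_flux (ode x xab) => n n4.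
  exact: Ck_closed_is_derive Cpsi n4 xab.
have := extendable_oo_primitive_on ab (extendable_oo_energy_density Cpsi) dflux
  (cvgP _ flux_a) (cvgP _ flux_b).
move=> /(primitive_on_increment (ltW ab)) ->.
by rewrite extend_oo_right// extend_oo_left /llim /rlim (cvg_lim _ flux_b)// (cvg_lim _ flux_a).
Qed.

(* The density exceeds the left-hand integrand by a sum of squares. *)
Lemma energy_flux_ge r psi a b : a < b -> 0 <= r <= rho -> 0 <= mu -> 0 <= lam ->
  Ck_closed 4 psi a b -> (forall x, a < x < b -> ode_at rho mu B xi lam psi x) ->
  (lam ^+ 2 * r + B ^+ 2 * xi ^+ 2) * int a b (fun x => derive1 psi x ^+ 2)
    + B ^+ 2 * xi ^+ 4 * int a b (fun x => psi x ^+ 2) <=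
  energy_flux (left_jet psi b) - energy_flux (right_jet psi a).
Proof.
move=> ab /andP[r0 r_le] mu0 lam0 Cpsi ode; rewrite -energy_identity//.
have sqr_itg n : (n <= 4)%N -> leb.-integrable `[a, b] (EFin \o (fun x => jet psi x n ^+ 2)).
  move=> n4; have ext_n := Ck_closed_extendable_oo Cpsi n4.
  exact: extendable_oo_integrable (extendable_ooM ext_n ext_n).
have psi2i := sqr_itg 0%N isT; have dpsi2i := sqr_itg 1%N isT.
rewrite -!RintegralZl// -RintegralD//; [|exact: integrable_itvZ|exact: integrable_itvZ].
apply: le_Rintegral => //.
- by apply: integrable_itvD; exact: integrable_itvZ.
- exact: extendable_oo_integrable (extendable_oo_energy_density Cpsi).
move=> x _; rewrite -subr_ge0 /energy_density /jet.
rewrite -[derive1 psi]/(derive1n 1 psi) -[psi x]/(derive1n 0 psi x).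
move: (derive1n 0 psi x) (derive1n 1 psi x) (derive1n 2 psi x) => d0 d1 d2.
rewrite (_ : _ - _ = lam ^+ 2 * rho * (xi * d0) ^+ 2 + lam ^+ 2 * (rho - r) * d1 ^+ 2
  + mu * lam * ((xi ^+ 2 * d0 + d2) ^+ 2 + (2 * xi * d1) ^+ 2)); last by ring.
have rho_r : 0 <= rho - r by rewrite subr_ge0.
have := mulr_ge0 (mulr_ge0 (sqr_ge0 lam) (le_trans r0 r_le)) (sqr_ge0 (xi * d0)).
have := mulr_ge0 (mulr_ge0 (sqr_ge0 lam) rho_r) (sqr_ge0 d1).
have := mulr_ge0 (mulr_ge0 mu0 lam0)
  (addr_ge0 (sqr_ge0 (xi ^+ 2 * d0 + d2)) (sqr_ge0 (2 * xi * d1))).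
by move=> viscous gap inertial; rewrite !addr_ge0.
Qed.

End EnergyIdentity.

Section Presolutions.
Variables (R : realType) (rhop rhom mup mum B xi lam : R).
Implicit Types (g : R) (psi : R -> R).

(* The problem without the jump condition on the normal stress; continuity at the interface is
   implied by [Ck_closed]. *)
Record presolution psi : Prop := Presolution {
  presolution_Ck_left : Ck_closed 4 psi (-1) 0;
  presolution_Ck_right : Ck_closed 4 psi 0 1;
  presolution_ode_left : forall x, -1 < x < 0 -> ode_at rhom mum B xi lam psi x;
  presolution_ode_right : forall x, 0 < x < 1 -> ode_at rhop mup B xi lam psi x;
  presolution_slope : right_jet psi 0 1 = left_jet psi 0 1;
  presolution_tangential :
    tangential_stress mup xi lam (right_jet psi 0) = tangential_stress mum xi lam (left_jet psi 0);
  presolution_bottom : psi (-1) = 0;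
  presolution_top : psi 1 = 0;
  presolution_slope_bottom : right_jet psi (-1) 1 = 0;
  presolution_slope_top : left_jet psi 1 1 = 0
}.

Definition normal_stress_jump psi : R :=
  normal_stress rhop mup xi lam (right_jet psi 0) - normal_stress rhom mum xi lam (left_jet psi 0).

Lemma Ck_closed_left_jet0 k psi a b : Ck_closed k psi a b -> left_jet psi b 0 = psi b.
Proof. by case=> _ [_ [_ [_ ->]]]. Qed.

Lemma Ck_closed_right_jet0 k psi a b : Ck_closed k psi a b -> right_jet psi a 0 = psi a.
Proof. by case=> _ [_ [_ [-> _]]]. Qed.

Lemma is_solutionP g psi : is_solution g rhop rhom mup mum B xi lam psi <->
  presolution psi /\ normal_stress_jump psi = g * (rhop - rhom) * xi ^+ 2 * psi 0.
Proof.
rewrite /normal_stress_jump /normal_stress /right_jet /left_jet; split.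
  move=> [Cl [Cr [ode_r [ode_l [_ [slope [tang [normal [bot [top [sbot stop]]]]]]]]]]].
  split; first by split; rewrite //; apply/eqP; rewrite -subr_eq0; apply/eqP.
  move: normal; move: (rlim (derive1n 3 psi) 0) (rlim (derive1n 1 psi) 0).
  by move: (llim (derive1n 3 psi) 0) (llim (derive1n 1 psi) 0) (psi 0); clear=> *; lra.
move=> [[Cl Cr ode_l ode_r slope tang bot top sbot stop] normal].
have cont : right_jet psi 0 0 - left_jet psi 0 0 = 0.
  by rewrite (Ck_closed_left_jet0 Cl) (Ck_closed_right_jet0 Cr) subrr.
have slope0 : right_jet psi 0 1 - left_jet psi 0 1 = 0 by rewrite slope subrr.
have tang0 : tangential_stress mup xi lam (right_jet psi 0)
    - tangential_stress mum xi lam (left_jet psi 0) = 0 by rewrite tang subrr.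
refine (conj Cl (conj Cr (conj ode_r (conj ode_l (conj cont (conj slope0
  (conj tang0 (conj _ (conj bot (conj top (conj sbot stop))))))))))).
rewrite -normal; move: (rlim (derive1n 3 psi) 0) (rlim (derive1n 1 psi) 0).
by move: (llim (derive1n 3 psi) 0) (llim (derive1n 1 psi) 0) => *; ring.
Qed.

Lemma presolution_H01 psi : presolution psi -> H01 psi (derive1 psi).
Proof.
move=> [Cl Cr _ _ _ _ bot top _ _]; apply/H01P.
have n10 := ltrN10 R.
have sqr_itg a b : a < b -> Ck_closed 4 psi a b -> itg a b (fun x => derive1 psi x ^+ 2).
  move=> ab Cpsi; have ext1 := Ck_closed_extendable_oo Cpsi (ltn0Sn _).
  exact: extendable_oo_integrable (extendable_ooM ext1 ext1).
split => //.
  exact: primitive_on_cat (ltW n10) ler01 (Ck_closed_primitive_on n10 Cl)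
    (Ck_closed_primitive_on ltr01 Cr).
exact: integrable_itv_cat (ltW n10) ler01 (sqr_itg _ _ n10 Cl) (sqr_itg _ _ ltr01 Cr).
Qed.

Lemma presolution_energy psi : 0 <= rhom -> rhom <= rhop -> 0 <= mup -> 0 <= mum -> 0 <= lam ->
  presolution psi ->
  lam ^+ 2 * rhom * L2sq (derive1 psi)
    + B ^+ 2 * xi ^+ 2 * (xi ^+ 2 * L2sq psi + L2sq (derive1 psi)) <=
  psi 0 * normal_stress_jump psi.
Proof.
move=> rhom0 rho_le mup0 mum0 lam0 pre; have H := presolution_H01 pre.
case: pre => Cl Cr ode_l ode_r slope tang bot top sbot stop.
have n10 := ltrN10 R; have n11 : (-1 : R) <= 1 by rewrite (le_trans (ltW n10)).
have /H01P[psi_primitive dpsi2i _ _] := H.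
have psi2i : itg (-1) 1 (fun x => psi x ^+ 2).
  have psic := primitive_on_continuous n11 psi_primitive.
  by apply: integrable_itv_within => x; apply: cvgM; exact: psic.
rewrite !L2sq_split//.
have := energy_flux_ge n10 _ mum0 lam0 Cl ode_l (r := rhom).
rewrite rhom0 lexx => /(_ isT) left_ge.
have := energy_flux_ge ltr01 _ mup0 lam0 Cr ode_r (r := rhom).
rewrite rhom0 rho_le => /(_ isT) right_ge.
move: (lerD left_ge right_ge).
rewrite /energy_flux (Ck_closed_left_jet0 Cl) (Ck_closed_right_jet0 Cl).
rewrite (Ck_closed_left_jet0 Cr) (Ck_closed_right_jet0 Cr) bot top sbot stop slope tang.
rewrite /normal_stress_jump; move: (int _ _ _) (int _ _ _) (int _ _ _) (int _ _ _).
move: (normal_stress _ _ _ _ _) (normal_stress _ _ _ _ _) (tangential_stress _ _ _ _).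
clear=> *; lra.
Qed.

End Presolutions.

(** * Explicit solutions *)

Section WallModes.
Variable R : realType.
Implicit Types (r s k t x : R) (n : nat).

Definition dsinh n x : R := if odd n then cosh x else sinh x.

(* The n-th derivative at t of sinh (s t) / s - sinh (k t) / k, which vanishes to second order
   at t = 0 and satisfies (D^2 - s^2) (D^2 - k^2) = 0. *)
Definition wall_mode n s k t : R :=
  s ^+ n / s * dsinh n (s * t) - k ^+ n / k * dsinh n (k * t).

#[global] Instance is_derive_dsinh n x : is_derive x 1 (dsinh n) (dsinh n.+1 x).
Proof. by rewrite /dsinh /=; case: odd; exact: _. Qed.

#[global] Instance is_derive_wall_mode n s k t :
  is_derive t 1 (wall_mode n s k) (wall_mode n.+1 s k t).
Proof.
have dscale r : is_derive t 1 (fun t => dsinh n (r * t)) (r * dsinh n.+1 (r * t)).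
  have d_linear : is_derive t 1 (fun t => r * t) r.
    by apply: is_derive_eq; rewrite /GRing.scale/= mulr1.
  by rewrite mulrC; exact: (is_derive1_comp (is_derive_dsinh n (r * t)) d_linear).
by apply: is_derive_eq; rewrite /GRing.scale/= /wall_mode !exprS; ring.
Qed.

Lemma dsinhN n x : dsinh n (- x) = (-1) ^+ n.+1 * dsinh n x.
Proof.
rewrite /dsinh -signr_odd /=; case: odd; rewrite ?coshN ?sinhN /=.
  by rewrite expr0 mul1r.
by rewrite expr1 mulN1r.
Qed.

Lemma wall_modeN n s k t : wall_mode n s k (- t) = (-1) ^+ n.+1 * wall_mode n s k t.
Proof. by rewrite /wall_mode !mulrN !dsinhN; ring. Qed.

Lemma wall_mode_rec n s k t : wall_mode n.+4 s k t =
  (s ^+ 2 + k ^+ 2) * wall_mode n.+2 s k t - s ^+ 2 * k ^+ 2 * wall_mode n s k t.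
Proof. by rewrite /wall_mode /dsinh /= !negbK !exprS; ring. Qed.

Lemma wall_mode_at0 n s k : (n <= 2)%N -> s != 0 -> k != 0 -> wall_mode n s k 0 = 0.
Proof.
move=> n2 s0 k0; rewrite /wall_mode !mulr0.
case: n n2 => [|[|[|]]]// _; rewrite /dsinh /= ?sinh0 ?cosh0 ?mulr0 ?subrr//.
by rewrite !expr1 !divff// subrr.
Qed.

Lemma continuous_wall_mode n k t s : s != 0 ->
  {for s, continuous (fun s => wall_mode n s k t)}.
Proof.
move=> s0; apply: cvgB; last exact: cvg_cst.
apply: cvgM; first by apply: cvgM; [exact: exprn_continuous|exact: cvgV].
apply: (continuous_comp (f := fun s => s * t)); first exact: mulrr_continuous.
exact: derivable_continuous.
Qed.

End WallModes.

Section Stiffness.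
Variable R : realType.
Implicit Types r s k t : R.

Definition clamped_det s k t : R :=
  wall_mode 1 s k t ^+ 2 - wall_mode 0 s k t * wall_mode 2 s k t.

Definition force_stiffness s k t : R :=
  (wall_mode 2 s k t * wall_mode 3 s k t - wall_mode 1 s k t * wall_mode 4 s k t)
  / clamped_det s k t.

Definition moment_stiffness s k t : R :=
  (wall_mode 1 s k t * wall_mode 2 s k t - wall_mode 0 s k t * wall_mode 3 s k t)
  / clamped_det s k t.

Definition cross_stiffness s k t : R :=
  (wall_mode 1 s k t * wall_mode 3 s k t - wall_mode 2 s k t ^+ 2) / clamped_det s k t.

Lemma clamped_detN s k t : clamped_det s k (- t) = clamped_det s k t.
Proof. by rewrite /clamped_det !wall_modeN; ring. Qed.

Lemma force_stiffnessN s k t : force_stiffness s k (- t) = - force_stiffness s k t.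
Proof. by rewrite /force_stiffness clamped_detN !wall_modeN; ring. Qed.

Lemma moment_stiffnessN s k t : moment_stiffness s k (- t) = - moment_stiffness s k t.
Proof. by rewrite /moment_stiffness clamped_detN !wall_modeN; ring. Qed.

Lemma cross_stiffnessN s k t : cross_stiffness s k (- t) = cross_stiffness s k t.
Proof. by rewrite /cross_stiffness clamped_detN !wall_modeN; ring. Qed.

Lemma clamped_detE s k t : s != 0 -> k != 0 ->
  clamped_det s k t = 2 - 2 * cosh (s * t) * cosh (k * t)
    + (k / s + s / k) * sinh (s * t) * sinh (k * t).
Proof.
move=> s0 k0.
transitivity ((cosh (s * t) ^+ 2 - sinh (s * t) ^+ 2)
   + (cosh (k * t) ^+ 2 - sinh (k * t) ^+ 2) - 2 * cosh (s * t) * cosh (k * t)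
   + (k / s + s / k) * sinh (s * t) * sinh (k * t)); last by rewrite !cosh2_sub_sinh2.
by rewrite /clamped_det /wall_mode /dsinh /=; field; rewrite s0 k0.
Qed.

Lemma clamped_det_gt0 s k t : 0 < k -> k < s -> 0 < t -> 0 < clamped_det s k t.
Proof.
move=> k0 ks t0; have s0 := lt_trans k0 ks.
rewrite clamped_detE ?gt_eqF//.
have -> : k / s + s / k = (k * t) / (s * t) + (s * t) / (k * t).
  by field; rewrite !gt_eqF.
by apply: sinh_cosh_det_gt0; rewrite ?mulr_gt0 ?ltr_pM2r.
Qed.

Lemma wall_mode_cross s k t : s != 0 -> k != 0 ->
  2 * wall_mode 1 s k t * wall_mode 3 s k t - wall_mode 0 s k t * wall_mode 4 s k t
    - wall_mode 2 s k t ^+ 2 =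
  (s ^+ 2 + k ^+ 2) * clamped_det s k t.
Proof.
move=> s0 k0; rewrite clamped_detE//.
transitivity (2 * s ^+ 2 * (cosh (s * t) ^+ 2 - sinh (s * t) ^+ 2)
   + 2 * k ^+ 2 * (cosh (k * t) ^+ 2 - sinh (k * t) ^+ 2)
   - 2 * (s ^+ 2 + k ^+ 2) * cosh (s * t) * cosh (k * t)
   + (s ^+ 2 + k ^+ 2) * (k / s + s / k) * sinh (s * t) * sinh (k * t)); last first.
  by rewrite !cosh2_sub_sinh2; ring.
by rewrite /wall_mode /dsinh /=; field; rewrite s0 k0.
Qed.

Lemma moment_stiffness_gt0 s k t : 0 < k -> k < s -> 0 < t -> 0 < moment_stiffness s k t.
Proof.
move=> k0 ks t0; have s0 := lt_trans k0 ks; apply: divr_gt0; last exact: clamped_det_gt0.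
have -> : wall_mode 1 s k t * wall_mode 2 s k t - wall_mode 0 s k t * wall_mode 3 s k t =
    (s ^+ 2 - k ^+ 2) / (2 * s * k * t) *
    ((s * t - k * t) * sinh (s * t + k * t) - (s * t + k * t) * sinh (s * t - k * t)).
  rewrite !sinhD coshN sinhN /wall_mode /dsinh /=; field.
  by rewrite !gt_eqF.
apply: mulr_gt0; first by rewrite divr_gt0 ?mulr_gt0// subr_gt0 ltr_sqr ?nnegrE ?ltW.
have kt0 : 0 < k * t by exact: mulr_gt0.
have kst : k * t < s * t by rewrite ltr_pM2r.
by rewrite subr_gt0 ltr_sinh_slope//; lra.
Qed.

Lemma continuous_stiffness k t s : 0 < k -> k < s -> 0 < t ->
  [/\ {for s, continuous (fun s => force_stiffness s k t)},
      {for s, continuous (fun s => cross_stiffness s k t)} &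
      {for s, continuous (fun s => moment_stiffness s k t)}].
Proof.
move=> k0 ks t0; have s0 : s != 0 by rewrite gt_eqF// (lt_trans k0).
have mode_c n := @continuous_wall_mode _ n k t s s0.
have det_inv : {for s, continuous (fun s => (clamped_det s k t)^-1)}.
  apply: continuousV; first by rewrite gt_eqF// clamped_det_gt0.
  by apply: cvgB; apply: cvgM; exact: mode_c.
by split; apply: cvgM => //; apply: cvgB; apply: cvgM; exact: mode_c.
Qed.

Lemma near_force_stiffness_lt k t r : 0 < k -> 0 < t -> k * cosh (k * t) < r * sinh (k * t) ->
  \forall s \near +oo, force_stiffness s k t < r * (s ^+ 2 - k ^+ 2).
Proof.
move=> k0 t0 r_gt.
have sk0 : 0 < sinh (k * t) by rewrite sinh_gt0 ?mulr_gt0.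
have ck0 := cosh_gt0 (k * t).
have r0 : 0 < r.
  by rewrite -(pmulr_lgt0 _ sk0); apply: lt_trans r_gt; exact: mulr_gt0.
pose e := r * (sinh (k * t) / k) - cosh (k * t).
have e0 : 0 < e by rewrite subr_gt0 mulrA ltr_pdivlMr// mulrC.
near=> s.
have s_large : 4 * r * cosh (k * t) < s * e.
  by rewrite -ltr_pdivrMr//; near: s; apply: nbhs_pinfty_gt; exact: num_real.
have st1 : 1 <= s * t.
  by rewrite -ler_pdivrMr//; near: s; apply: nbhs_pinfty_ge; exact: num_real.
have ks : k < s by near: s; apply: nbhs_pinfty_gt; exact: num_real.
have s0 := lt_trans k0 ks; have ss0 : 0 < sinh (s * t) by rewrite sinh_gt0 ?mulr_gt0.
have cs0 := cosh_gt0 (s * t).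
have D0 := clamped_det_gt0 k0 ks t0.
rewrite ltr_pdivrMr//.
have -> : wall_mode 2 s k t * wall_mode 3 s k t - wall_mode 1 s k t * wall_mode 4 s k t =
    (s ^+ 2 - k ^+ 2)
    * (s * sinh (s * t) * cosh (k * t) - k * cosh (s * t) * sinh (k * t)).
  by rewrite /wall_mode /dsinh /=; field; rewrite !gt_eqF.
have sk2 : 0 < s ^+ 2 - k ^+ 2 by rewrite subr_gt0 ltr_sqr ?nnegrE ?ltW.
rewrite [r * _]mulrC -[ltRHS]mulrA ltr_pM2l// clamped_detE ?gt_eqF//.
have cosh_le : r * cosh (s * t) * cosh (k * t) <= r * (2 * sinh (s * t)) * cosh (k * t).
  by rewrite ler_pM2r// ler_pM2l// cosh_le_2sinh.
have lead_gt0 : 0 < sinh (s * t) * (s * e - 4 * r * cosh (k * t)).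
  by rewrite mulr_gt0// subr_gt0.
have cosh_term_gt0 := mulr_gt0 (mulr_gt0 k0 cs0) sk0.
have sinh_term_gt0 := mulr_gt0 (mulr_gt0 r0 (divr_gt0 k0 s0)) (mulr_gt0 ss0 sk0).
have -> : r * (2 - 2 * cosh (s * t) * cosh (k * t)
                 + (k / s + s / k) * sinh (s * t) * sinh (k * t))
    = r * 2 - 2 * (r * cosh (s * t) * cosh (k * t)) + r * (k / s) * (sinh (s * t) * sinh (k * t))
      + s * sinh (s * t) * (r * (sinh (k * t) / k)) by ring.
by rewrite /e in lead_gt0; lra.
Unshelve. all: by end_near. Qed.

End Stiffness.

Section ClampedSolutions.
Variables (R : realType) (s k t : R).
Hypotheses (k0 : 0 < k) (ks : k < s) (t0 : t != 0).
Implicit Types (a b y : R) (n : nat).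

Definition clamped a b n y : R :=
  ((wall_mode 1 s k t * a - wall_mode 0 s k t * b) * wall_mode n.+1 s k y
   + (wall_mode 1 s k t * b - wall_mode 2 s k t * a) * wall_mode n s k y) / clamped_det s k t.

Lemma clamped_det_neq0 : clamped_det s k t != 0.
Proof.
move: t0; rewrite neq_lt => /orP[t_lt0|t_gt0]; last by rewrite gt_eqF// clamped_det_gt0.
by rewrite -clamped_detN gt_eqF// clamped_det_gt0// oppr_gt0.
Qed.

Lemma is_derive_clamped a b n y : is_derive y 1 (clamped a b n) (clamped a b n.+1 y).
Proof.
rewrite /clamped; set p := _ - _; set q := _ - _.
by apply: is_derive_eq; rewrite /GRing.scale/=; ring.
Qed.

Lemma clamped_displacement a b : clamped a b 0 t = a.
Proof.
by have := clamped_det_neq0; rewrite /clamped /clamped_det => ?; field.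
Qed.

Lemma clamped_slope a b : clamped a b 1 t = b.
Proof.
by have := clamped_det_neq0; rewrite /clamped /clamped_det => ?; field.
Qed.

Lemma clamped_moment a b :
  clamped a b 2 t = cross_stiffness s k t * a + moment_stiffness s k t * b.
Proof. by rewrite /clamped /cross_stiffness /moment_stiffness; ring. Qed.

Lemma clamped_force a b : clamped a b 3 t =
  (s ^+ 2 + k ^+ 2 - cross_stiffness s k t) * b - force_stiffness s k t * a.
Proof.
have s0 := lt_trans k0 ks.
have -> : s ^+ 2 + k ^+ 2 = (s ^+ 2 + k ^+ 2) * clamped_det s k t / clamped_det s k t.
  by rewrite mulfK// clamped_det_neq0.
rewrite -wall_mode_cross ?gt_eqF//.
by rewrite /clamped /cross_stiffness /force_stiffness; ring.
Qed.

Lemma clamped_wall a b n : (n <= 1)%N -> clamped a b n 0 = 0.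
Proof.
move=> n1; have s0 := lt_trans k0 ks.
by rewrite /clamped !wall_mode_at0 ?gt_eqF// ?(leq_trans n1)// !mulr0 addr0 mul0r.
Qed.

Lemma clamped_rec a b y :
  clamped a b 4 y = (s ^+ 2 + k ^+ 2) * clamped a b 2 y - s ^+ 2 * k ^+ 2 * clamped a b 0 y.
Proof. by rewrite /clamped !wall_mode_rec; ring. Qed.

End ClampedSolutions.

Section ClampedStresses.
Variables (R : realType) (s k t rho mu B lam : R).
Hypotheses (k0 : 0 < k) (ks : k < s) (t0 : t != 0).
Hypothesis decay_rel : mu * lam * (s ^+ 2 - k ^+ 2) = lam ^+ 2 * rho + B ^+ 2 * k ^+ 2.
Implicit Types (a b y : R).

Lemma clamped_ode a b y : jet_ode rho mu B k lam (clamped s k t a b ^~ y).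
Proof.
rewrite /jet_ode /= clamped_rec.
move: (clamped s k t a b 0 y) (clamped s k t a b 2 y) => d0 d2.
apply/eqP; rewrite -subr_eq0; apply/eqP.
transitivity ((d2 - k ^+ 2 * d0)
  * (lam ^+ 2 * rho + B ^+ 2 * k ^+ 2 - mu * lam * (s ^+ 2 - k ^+ 2))); first by ring.
by rewrite decay_rel subrr mulr0.
Qed.

Lemma clamped_tangential_stress a b : tangential_stress mu k lam (clamped s k t a b ^~ t) =
  mu * lam * ((k ^+ 2 + cross_stiffness s k t) * a + moment_stiffness s k t * b).
Proof.
by rewrite /tangential_stress /= clamped_displacement// clamped_moment; ring.
Qed.

Lemma clamped_normal_stress a b : normal_stress rho mu k lam (clamped s k t a b ^~ t) =
  (B ^+ 2 * k ^+ 2 - mu * lam * (k ^+ 2 + cross_stiffness s k t)) * b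
    - mu * lam * force_stiffness s k t * a.
Proof.
have -> : B ^+ 2 * k ^+ 2 = mu * lam * (s ^+ 2 - k ^+ 2) - lam ^+ 2 * rho.
  by rewrite decay_rel addrC addrA addNr add0r.
by rewrite /normal_stress /= clamped_slope// clamped_force//; ring.
Qed.

End ClampedStresses.

Section SmoothPieces.
Variables (R : realType) (f : R -> R) (P : nat -> R -> R) (a b : R).
Hypotheses (ab : a < b) (fP : {in `[a, b], f =1 P 0%N}).
Hypothesis dP : forall n (x : R), is_derive x 1 (P n) (P n.+1 x).

Lemma smooth_piece_derive1n n : {in `]a, b[, derive1n n f =1 P n}.
Proof.
elim: n => [|n IH] x xab; first by apply: fP; apply: subset_itv_oo_cc.
rewrite [LHS]derive1E -[RHS]derive_val; apply: near_eq_derive.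
by near=> y; apply: IH; near: y; exact: near_in_itvoo.
Unshelve. all: by end_near. Qed.

Lemma smooth_piece_jet x : a < x < b -> jet f x = P^~ x.
Proof. by move=> xab; apply/funext => n; exact: smooth_piece_derive1n. Qed.

Lemma smooth_piece_ode rho mu B xi lam x : a < x < b ->
  jet_ode rho mu B xi lam (P^~ x) -> ode_at rho mu B xi lam f x.
Proof. by move=> xab; rewrite -smooth_piece_jet. Qed.

Lemma smooth_piece_smooth_open : smooth_open f a b.
Proof.
move=> n x xab; have [dPx _] := dP n x; apply: near_eq_derivable dPx.
by near=> y; rewrite smooth_piece_derive1n//; near: y; exact: near_in_itvoo.
Unshelve. all: by end_near. Qed.

Lemma smooth_piece_cvg_right n : derive1n n f x @[x --> a^'+] --> P n a.
Proof.
have : P n x @[x --> a^'+] --> P n a.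
  by apply: cvg_at_right_filter; apply: derivable_continuous.
apply: cvg_trans; apply: near_eq_cvg; near=> x; rewrite smooth_piece_derive1n// in_itv/=.
by apply/andP; split; near: x; [exact: nbhs_right_gt|exact: nbhs_right_lt].
Unshelve. all: by end_near. Qed.

Lemma smooth_piece_cvg_left n : derive1n n f x @[x --> b^'-] --> P n b.
Proof.
have : P n x @[x --> b^'-] --> P n b.
  by apply: cvg_at_left_filter; apply: derivable_continuous.
apply: cvg_trans; apply: near_eq_cvg; near=> x; rewrite smooth_piece_derive1n// in_itv/=.
by apply/andP; split; near: x; [exact: nbhs_left_gt|exact: nbhs_left_lt].
Unshelve. all: by end_near. Qed.

Lemma smooth_piece_right_jet : right_jet f a = P^~ a.
Proof. by apply/funext => n; apply: cvg_lim => //; exact: smooth_piece_cvg_right. Qed.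

Lemma smooth_piece_left_jet : left_jet f b = P^~ b.
Proof. by apply/funext => n; apply: cvg_lim => //; exact: smooth_piece_cvg_left. Qed.

Lemma smooth_piece_Ck k : Ck_closed k f a b.
Proof.
split; first by move=> n _; exact: smooth_piece_smooth_open.
split; first by move=> x xab; exact/derivable_continuous/smooth_piece_smooth_open.
split=> [n _|].
  split; apply/cvg_ex.
    by exists (P n a); exact: smooth_piece_cvg_right.
  by exists (P n b); exact: smooth_piece_cvg_left.
split; rewrite fP ?in_itv/= ?lexx ?ltW//.
- by rewrite -[rlim f a]/(right_jet f a 0) smooth_piece_right_jet.
- by rewrite -[llim f b]/(left_jet f b 0) smooth_piece_left_jet.
Qed.

End SmoothPieces.

Lemma is_derive_shift (R : realType) (f : R -> R) (c x df : R) :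
  is_derive (x + c) 1 f df -> is_derive x 1 (fun y => f (y + c)) df.
Proof.
move=> fxc; have d_shift : is_derive x 1 (fun y => y + c) (1 : R).
  by apply: is_derive_eq; rewrite addr0.
have := @is_derive1_comp R f (fun y => y + c) x df 1 fxc d_shift.
by move=> /is_derive_eq; apply; rewrite mulr1.
Qed.

Section Gluing.
Variables (R : realType) (U V : nat -> R -> R).
Hypothesis dU : forall n (x : R), is_derive x 1 (U n) (U n.+1 x).
Hypothesis dV : forall n (x : R), is_derive x 1 (V n) (V n.+1 x).
Hypothesis UV0 : U 0%N 0 = V 0%N 0.
Implicit Types (rhop rhom mup mum B xi lam x : R).

Definition glue x : R := if x <= 0 then U 0%N x else V 0%N x.

Let n10 := ltrN10 R.

Let glue_left : {in `[-1, 0], glue =1 U 0%N}.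
Proof. by move=> x; rewrite in_itv/= /glue => /andP[_ ->]. Qed.

Let glue_right : {in `[0, 1], glue =1 V 0%N}.
Proof.
move=> x; rewrite in_itv/= /glue => /andP[x0 _]; case: ifP => // x_le0.
by have -> : x = 0 by apply/le_anti; rewrite x_le0.
Qed.

Lemma glue_smooth_left : smooth_open glue (-1) 0.
Proof. exact: smooth_piece_smooth_open glue_left dU. Qed.

Lemma glue_smooth_right : smooth_open glue 0 1.
Proof. exact: smooth_piece_smooth_open glue_right dV. Qed.

Lemma glue_normal_stress_jump rhop rhom mup mum xi lam :
  normal_stress_jump rhop rhom mup mum xi lam glue =
  normal_stress rhop mup xi lam (V ^~ 0) - normal_stress rhom mum xi lam (U ^~ 0).
Proof.
by rewrite /normal_stress_jump (smooth_piece_right_jet ltr01 glue_right dV)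
  (smooth_piece_left_jet n10 glue_left dU).
Qed.

Lemma presolution_glue rhop rhom mup mum B xi lam :
  (forall x, jet_ode rhom mum B xi lam (U ^~ x)) ->
  (forall x, jet_ode rhop mup B xi lam (V ^~ x)) ->
  V 1%N 0 = U 1%N 0 ->
  tangential_stress mup xi lam (V ^~ 0) = tangential_stress mum xi lam (U ^~ 0) ->
  (forall n, (n <= 1)%N -> U n (-1) = 0) -> (forall n, (n <= 1)%N -> V n 1 = 0) ->
  presolution rhop rhom mup mum B xi lam glue.
Proof.
move=> odeU odeV slope tangential U_wall V_wall.
have glue_jetE := (smooth_piece_right_jet ltr01 glue_right dV,
  smooth_piece_left_jet n10 glue_left dU).
split.
- exact: smooth_piece_Ck n10 glue_left dU 4.
- exact: smooth_piece_Ck ltr01 glue_right dV 4.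
- by move=> x x_in; exact: (smooth_piece_ode glue_left dU x_in (odeU x)).
- by move=> x x_in; exact: (smooth_piece_ode glue_right dV x_in (odeV x)).
- by rewrite !glue_jetE.
- by rewrite !glue_jetE.
- by rewrite glue_left ?U_wall// in_itv/= lexx ltW.
- by rewrite glue_right ?V_wall// in_itv/= lexx ler01.
- by rewrite (smooth_piece_right_jet n10 glue_left dU) U_wall.
- by rewrite (smooth_piece_left_jet ltr01 glue_right dV) V_wall.
Qed.

End Gluing.

(** * The dispersion relation *)

Section Dispersion.
Variables (R : realType) (grho rhop rhom mup mum B k : R).
Hypotheses (rhom0 : 0 < rhom) (rho_lt : rhom < rhop) (mup0 : 0 < mup) (mum0 : 0 < mum).
Hypotheses (B0 : B != 0) (k0 : 0 < k).
Implicit Types (rho mu lam x c : R).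

Let rhop0 : 0 < rhop. Proof. exact: lt_trans rho_lt. Qed.
Let Bk2 : 0 < B ^+ 2 * k ^+ 2. Proof. by rewrite mulr_gt0// exprn_even_gt0//= gt_eqF. Qed.

Definition decay rho mu lam : R :=
  Num.sqrt (k ^+ 2 + (lam ^+ 2 * rho + B ^+ 2 * k ^+ 2) / (mu * lam)).

Lemma decay_sqr rho mu lam : 0 < rho -> 0 < mu -> 0 < lam ->
  mu * lam * (decay rho mu lam ^+ 2 - k ^+ 2) = lam ^+ 2 * rho + B ^+ 2 * k ^+ 2.
Proof.
move=> r0 m0 l0; have ml0 := mulr_gt0 m0 l0.
rewrite sqr_sqrtr; first by rewrite addrC addKr mulrC mulfVK// gt_eqF.
by rewrite addr_ge0 ?sqr_ge0// divr_ge0 ?ltW// addr_gt0// mulr_gt0// exprn_gt0.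
Qed.

Lemma decay_gt rho mu lam : 0 < rho -> 0 < mu -> 0 < lam -> k < decay rho mu lam.
Proof.
move=> r0 m0 l0; rewrite -(ltr_pXn2r (n := 2))// ?nnegrE ?sqrtr_ge0 ?ltW//.
rewrite -subr_gt0 -(pmulr_rgt0 _ (mulr_gt0 m0 l0)) decay_sqr// addr_gt0//.
by rewrite mulr_gt0// exprn_gt0.
Qed.

Lemma decay_cvg_pinfty rho mu : 0 < rho -> 0 < mu -> decay rho mu lam @[lam --> 0^'+] --> +oo.
Proof.
move=> r0 m0; apply/cvgryPge => A; have A20 : 0 < A ^+ 2 + 1 by rewrite ltr_pwDr// sqr_ge0.
near=> lam.
have l0 : 0 < lam by near: lam; exact: nbhs_right_gt.
have lam_le : lam <= B ^+ 2 * k ^+ 2 / (mu * (A ^+ 2 + 1)).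
  by near: lam; apply: nbhs_right_le; rewrite divr_gt0// mulr_gt0.
apply: le_trans (ler_norm A) _; rewrite -sqrtr_sqr; apply: ler_wsqrtr.
rewrite -[leLHS]addr0 [leRHS]addrC.
have ml0 := mulr_gt0 m0 l0.
rewrite lerD ?sqr_ge0// ler_pdivlMr//.
move: lam_le; rewrite ler_pdivlMr ?mulr_gt0// => lam_le.
have := mulr_ge0 (sqr_ge0 lam) (ltW r0); lra.
Unshelve. all: by end_near. Qed.

(* As [lam] tends to 0 the left-hand side tends to [B ^+ 2 * k ^+ 2 * (k * coth k)]. *)
Lemma near0_force_stiffness_lt rho mu c : 0 < rho -> 0 < mu ->
  B ^+ 2 * k ^+ 2 * (k * cosh k) < c * sinh k ->
  \forall lam \near 0^'+, mu * lam * force_stiffness (decay rho mu lam) k 1 < c.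
Proof.
move=> r0 m0 c_gt; have sk0 := sinh_gt0 k0.
pose r := (k * cosh k / sinh k + c / (B ^+ 2 * k ^+ 2)) / 2.
have coth_lt : k * cosh k / sinh k < c / (B ^+ 2 * k ^+ 2).
  by rewrite ltr_pdivrMr// mulrAC ltr_pdivlMr// mulrC.
have r_gt : k * cosh (k * 1) < r * sinh (k * 1).
  by rewrite mulr1 -ltr_pdivrMr// /r; lra.
have r_lt : r * (B ^+ 2 * k ^+ 2) < c by rewrite -ltr_pdivlMr// /r; lra.
have r_gt0 : 0 < r.
  rewrite -(pmulr_lgt0 _ sk0) -[k in sinh k]mulr1; apply: lt_trans r_gt.
  exact: mulr_gt0 k0 (cosh_gt0 _).
clearbody r; have stiff_near : \forall lam \near 0^'+,
    force_stiffness (decay rho mu lam) k 1 < r * (decay rho mu lam ^+ 2 - k ^+ 2).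
  have stiff_pinfty := near_force_stiffness_lt k0 ltr01 r_gt.
  by have := decay_cvg_pinfty r0 m0 stiff_pinfty.
near=> lam.
have l0 : 0 < lam by near: lam; exact: nbhs_right_gt.
have l1 : lam <= 1 by near: lam; exact: nbhs_right_le.
have inertia_lt : lam < (c - r * (B ^+ 2 * k ^+ 2)) / (r * rho).
  by near: lam; apply: nbhs_right_lt; rewrite divr_gt0 ?subr_gt0// mulr_gt0.
have stiff_lt : force_stiffness (decay rho mu lam) k 1 < r * (decay rho mu lam ^+ 2 - k ^+ 2).
  by near: lam; exact: stiff_near.
have ml0 := mulr_gt0 m0 l0.
have {stiff_lt} := stiff_lt; rewrite -(ltr_pM2l ml0) => /lt_trans; apply.
rewrite mulrCA decay_sqr//.
move: inertia_lt; rewrite ltr_pdivlMr ?mulr_gt0// => inertia_lt.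
have lam2_le : lam ^+ 2 <= lam by rewrite expr2 ger_pMl.
have := ler_wpM2r (ltW (mulr_gt0 r_gt0 r0)) lam2_le; lra.
Unshelve. all: by end_near. Qed.

Definition interface_force lam : R :=
  mup * lam * force_stiffness (decay rhop mup lam) k 1
  + mum * lam * force_stiffness (decay rhom mum lam) k 1.

Definition interface_moment lam : R :=
  mup * lam * moment_stiffness (decay rhop mup lam) k 1
  + mum * lam * moment_stiffness (decay rhom mum lam) k 1.

Definition interface_cross lam : R :=
  mup * lam * (k ^+ 2 + cross_stiffness (decay rhop mup lam) k 1)
  - mum * lam * (k ^+ 2 + cross_stiffness (decay rhom mum lam) k 1).

Definition dispersion lam : R :=
  interface_force lam * interface_moment lam - interface_cross lam ^+ 2
  - grho * k ^+ 2 * interface_moment lam.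

Lemma interface_moment_gt0 lam : 0 < lam -> 0 < interface_moment lam.
Proof.
move=> l0; have moment_gt0 rho mu : 0 < rho -> 0 < mu ->
    0 < mu * lam * moment_stiffness (decay rho mu lam) k 1.
  move=> r0 m0; apply: mulr_gt0 (mulr_gt0 m0 l0) _.
  by apply: moment_stiffness_gt0; [|exact: decay_gt|].
by rewrite addr_gt0 ?moment_gt0.
Qed.

Lemma near0_dispersion_lt0 : B ^+ 2 * (2 * k * cosh k) < grho * sinh k ->
  \forall lam \near 0^'+, dispersion lam < 0.
Proof.
move=> subcritical; pose c := grho * k ^+ 2 / 2.
have c_gt : B ^+ 2 * k ^+ 2 * (k * cosh k) < c * sinh k.
  have k22 : 0 < k ^+ 2 / 2 by rewrite divr_gt0// exprn_gt0.
  by move: subcritical; rewrite -(ltr_pM2l k22) /c; lra.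
near=> lam.
have l0 : 0 < lam by near: lam; exact: nbhs_right_gt.
have force_p : mup * lam * force_stiffness (decay rhop mup lam) k 1 < c.
  by near: lam; exact: near0_force_stiffness_lt.
have force_m : mum * lam * force_stiffness (decay rhom mum lam) k 1 < c.
  by near: lam; exact: near0_force_stiffness_lt.
have moment0 := interface_moment_gt0 l0.
have force_lt : interface_force lam - grho * k ^+ 2 < 0.
  by move: (ltrD force_p force_m); rewrite -/(interface_force lam) /c; lra.
have : (interface_force lam - grho * k ^+ 2) * interface_moment lam < 0 by rewrite nmulr_rlt0.
by rewrite /dispersion; have := sqr_ge0 (interface_cross lam); lra.
Unshelve. all: by end_near. Qed.

Lemma continuous_decay rho mu lam : 0 < mu -> 0 < lam -> {for lam, continuous (decay rho mu)}.
Proof.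
move=> m0 l0; apply: continuous_comp; last exact: sqrt_continuous.
apply: cvgD; first exact: cvg_cst.
apply: cvgM.
  by apply: cvgD (cvg_cst _); apply: cvgM (cvg_cst _); exact: exprn_continuous.
apply: cvgV; first by rewrite gt_eqF// mulr_gt0.
exact: mulrl_continuous.
Qed.

Lemma continuous_dispersion lam : 0 < lam -> {for lam, continuous dispersion}.
Proof.
move=> l0.
have side_c rho mu (h : R -> R) : 0 < mu -> {for decay rho mu lam, continuous h} ->
    {for lam, continuous (fun lam => mu * lam * h (decay rho mu lam))}.
  move=> m0 hc; apply: cvgM; first exact: mulrl_continuous.
  by apply: continuous_comp hc; exact: continuous_decay.
have [fp cp mp] := continuous_stiffness k0 (decay_gt rhop0 mup0 l0) ltr01.
have [fm cm mm] := continuous_stiffness k0 (decay_gt rhom0 mum0 l0) ltr01.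
have force_c : {for lam, continuous interface_force}.
  by apply: cvgD; [exact: side_c fp|exact: side_c fm].
have moment_c : {for lam, continuous interface_moment}.
  by apply: cvgD; [exact: side_c mp|exact: side_c mm].
have shift_c (h : R -> R) x : {for x, continuous h} ->
    {for x, continuous (fun x => k ^+ 2 + h x)}.
  by move=> hc; apply: cvgD hc; exact: cvg_cst.
have cross_c : {for lam, continuous interface_cross}.
  by apply: cvgB; [exact: side_c (shift_c _ _ cp)|exact: side_c (shift_c _ _ cm)].
apply: cvgB; last by apply: cvgM moment_c; exact: cvg_cst.
by apply: cvgB; apply: cvgM.
Qed.

Definition bottom_mode lam n x : R :=
  clamped (decay rhom mum lam) k 1 (interface_moment lam) (interface_cross lam) n (x + 1).

Definition top_mode lam n x : R :=
  clamped (decay rhop mup lam) k (-1) (interface_moment lam) (interface_cross lam) n (x - 1).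

Definition profile lam : R -> R := glue (bottom_mode lam) (top_mode lam).

Lemma is_derive_bottom_mode lam n x :
  is_derive x 1 (bottom_mode lam n) (bottom_mode lam n.+1 x).
Proof. exact/is_derive_shift/is_derive_clamped. Qed.

Lemma is_derive_top_mode lam n x : is_derive x 1 (top_mode lam n) (top_mode lam n.+1 x).
Proof. exact/is_derive_shift/is_derive_clamped. Qed.

Lemma bottom_mode0 lam : bottom_mode lam ^~ 0 =
  clamped (decay rhom mum lam) k 1 (interface_moment lam) (interface_cross lam) ^~ 1.
Proof. by apply/funext => n; rewrite /bottom_mode add0r. Qed.

Lemma top_mode0 lam : top_mode lam ^~ 0 =
  clamped (decay rhop mup lam) k (-1) (interface_moment lam) (interface_cross lam) ^~ (-1).
Proof. by apply/funext => n; rewrite /top_mode sub0r. Qed.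

Section Profile.
Variable lam : R.
Hypothesis lam0 : 0 < lam.

Let decayp : k < decay rhop mup lam. Proof. exact: decay_gt. Qed.
Let decaym : k < decay rhom mum lam. Proof. exact: decay_gt. Qed.
Let sqrp := decay_sqr rhop0 mup0 lam0.
Let sqrm := decay_sqr rhom0 mum0 lam0.

Let displacement_eq : bottom_mode lam 0 0 = top_mode lam 0 0.
Proof. by rewrite /bottom_mode /top_mode !add0r !clamped_displacement// oppr_eq0. Qed.

Lemma profile_at0 : profile lam 0 = interface_moment lam.
Proof. by rewrite /profile /glue lexx /bottom_mode add0r clamped_displacement. Qed.

Lemma presolution_profile : presolution rhop rhom mup mum B k lam (profile lam).
Proof.
apply: presolution_glue.
- exact: is_derive_bottom_mode.
- exact: is_derive_top_mode.
- exact: displacement_eq.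
- by move=> x; exact: clamped_ode.
- by move=> x; exact: clamped_ode.
- by rewrite /bottom_mode /top_mode !add0r !clamped_slope// oppr_eq0.
- rewrite bottom_mode0 top_mode0 !clamped_tangential_stress ?oppr_eq0//.
  by rewrite cross_stiffnessN moment_stiffnessN /interface_moment /interface_cross; ring.
- by move=> n n1; rewrite /bottom_mode addNr clamped_wall.
- by move=> n n1; rewrite /top_mode subrr clamped_wall.
Qed.

Lemma profile_normal_stress_jump : normal_stress_jump rhop rhom mup mum k lam (profile lam) =
  interface_force lam * interface_moment lam - interface_cross lam ^+ 2.
Proof.
rewrite (glue_normal_stress_jump (is_derive_bottom_mode lam) (is_derive_top_mode lam)
  displacement_eq) bottom_mode0 top_mode0.
rewrite (clamped_normal_stress k0 decayp _ sqrp) ?oppr_eq0//.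
rewrite (clamped_normal_stress k0 decaym _ sqrm)// cross_stiffnessN force_stiffnessN.
by rewrite /interface_force; set a := interface_moment lam; rewrite /interface_cross; ring.
Qed.

Lemma profile_smooth : smooth_open (profile lam) (-1) 0 /\ smooth_open (profile lam) 0 1.
Proof.
split; first exact: glue_smooth_left (is_derive_bottom_mode lam).
exact: glue_smooth_right (is_derive_top_mode lam) displacement_eq.
Qed.

Lemma dispersion_ge0 : grho * k ^+ 2 <= 2 * (lam ^+ 2 * rhom) -> 0 <= dispersion lam.
Proof.
move=> inertia_ge; have pre := presolution_profile.
have := presolution_energy (ltW rhom0) (ltW rho_lt) (ltW mup0) (ltW mum0) (ltW lam0) pre.
rewrite profile_at0 profile_normal_stress_jump.
have := H01_sqr0_le (presolution_H01 pre); rewrite profile_at0.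
have magnetic_ge0 := mulr_ge0 (ltW Bk2)
  (addr_ge0 (mulr_ge0 (sqr_ge0 k) (L2sq_ge0 (profile lam))) (L2sq_ge0 (derive1 (profile lam)))).
have lam2_rho_ge0 := mulr_ge0 (sqr_ge0 lam) (ltW rhom0).
move=> /(ler_wpM2l lam2_rho_ge0) trace energy.
have := ler_wpM2r (sqr_ge0 (interface_moment lam)) inertia_ge.
rewrite -(pmulr_rge0 _ (interface_moment_gt0 lam0)) /dispersion.
move: magnetic_ge0 trace energy; move: (L2sq _) (L2sq _) (interface_moment lam).
move: (interface_force lam) (interface_cross lam) => *; lra.
Qed.

End Profile.

Lemma near_pinfty_dispersion_ge0 : \forall lam \near +oo, 0 <= dispersion lam.
Proof.
near=> lam.
have lam1 : 1 <= lam by near: lam; apply: nbhs_pinfty_ge; exact: num_real.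
have lam_ge : grho * k ^+ 2 / (2 * rhom) <= lam.
  by near: lam; apply: nbhs_pinfty_ge; exact: num_real.
apply: dispersion_ge0; first exact: lt_le_trans lam1.
have lam2 : lam <= lam ^+ 2 by rewrite expr2 ler_peMl// (le_trans _ lam1).
move: lam_ge; rewrite ler_pdivrMr ?mulr_gt0// => lam_ge.
by have := ler_wpM2r (ltW rhom0) lam2; lra.
Unshelve. all: by end_near. Qed.

Lemma dispersion_has_root : B ^+ 2 * (2 * k * cosh k) < grho * sinh k ->
  exists2 lam, 0 < lam & dispersion lam = 0.
Proof.
move=> subcritical.
have [lam1 [lam1_gt0 neg]] : exists lam, 0 < lam /\ dispersion lam < 0.
  apply: (@filter_ex _ 0^'+); near=> lam; split; near: lam.
    exact: nbhs_right_gt.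
  exact: near0_dispersion_lt0.
have [lam2 [lam12 nneg]] : exists lam, lam1 <= lam /\ 0 <= dispersion lam.
  apply: (@filter_ex _ (pinfty_nbhs R)); near=> lam; split; near: lam.
    by apply: nbhs_pinfty_ge; exact: num_real.
  exact: near_pinfty_dispersion_ge0.
have dispersion_c : {within `[lam1, lam2], continuous dispersion}.
  apply: continuous_in_subspaceT => lam; rewrite inE/= in_itv/= => /andP[lam1_le _].
  exact/continuous_dispersion/(lt_le_trans lam1_gt0).
have [|lam] := IVT lam12 dispersion_c (v := 0).
  by rewrite ge_min (ltW neg) le_max nneg orbT.
rewrite in_itv/= => /andP[lam1_le _] root; exists lam => //.
exact: lt_le_trans lam1_gt0 lam1_le.
Unshelve. all: by end_near. Qed.

Lemma exists_growing_mode g : grho = g * (rhop - rhom) -> k < xihc grho B ->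
  exists lam psi, [/\ 0 < lam, is_solution g rhop rhom mup mum B k lam psi,
    smooth_open psi (-1) 0, smooth_open psi 0 1 & psi 0 != 0].
Proof.
move=> grhoE /(lt_xihc B0 k0)/dispersion_has_root[lam lam0 root].
have [smoothl smoothr] := profile_smooth lam0.
exists lam, (profile lam); split => //; last by rewrite profile_at0// gt_eqF ?interface_moment_gt0.
apply/is_solutionP; split; first exact: presolution_profile.
rewrite profile_normal_stress_jump// profile_at0// -grhoE.
by apply/eqP; rewrite -subr_eq0; apply/eqP.
Qed.

End Dispersion.

Section Solutions.
Variable R : realType.
Implicit Types (g rhop rhom mup mum B xi lam : R) (psi : R -> R).

Lemma energy_bound_trivial g rhop rhom mup mum B xi lam psi :
  0 < rhom -> rhom <= rhop -> 0 <= mup -> 0 <= mum -> 0 < lam ->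
  (forall dpsi, H01 psi dpsi ->
    g * (rhop - rhom) * psi 0 ^+ 2 <= B ^+ 2 * (xi ^+ 2 * L2sq psi + L2sq dpsi)) ->
  is_solution g rhop rhom mup mum B xi lam psi -> ~ nontrivial psi.
Proof.
move=> rhom0 rho_le mup0 mum0 lam0 bound /is_solutionP[pre jump] [x [x_in /negP[]]].
have H := presolution_H01 pre.
have := presolution_energy (ltW rhom0) rho_le mup0 mum0 (ltW lam0) pre.
rewrite jump => energy; have := ler_wpM2l (sqr_ge0 xi) (bound _ H) => magnetic.
have inertia_le0 : lam ^+ 2 * rhom * L2sq (derive1 psi) <= 0.
  move: magnetic energy; move: (L2sq _) (L2sq _) (psi 0); clear=> *; lra.
have dpsi_le0 : L2sq (derive1 psi) <= 0.
  by rewrite -(pmulr_rle0 _ (mulr_gt0 (exprn_gt0 2 lam0) rhom0)).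
rewrite -sqrf_eq0; apply/eqP/le_anti; rewrite sqr_ge0 andbT.
by apply: le_trans (H01_sqr_le H x_in) _; rewrite pmulr_rle0.
Qed.

Lemma is_solutionN g rhop rhom mup mum B xi lam psi :
  is_solution g rhop rhom mup mum B (- xi) lam psi <->
  is_solution g rhop rhom mup mum B xi lam psi.
Proof.
have xi4 : (- xi) ^+ 4 = xi ^+ 4 by ring.
by rewrite /is_solution /ode_at sqrrN xi4.
Qed.

Lemma is_solution_norm g rhop rhom mup mum B xi lam psi :
  is_solution g rhop rhom mup mum B `|xi| lam psi <->
  is_solution g rhop rhom mup mum B xi lam psi.
Proof. by have [_|_] := ger0P xi; [|exact: is_solutionN]. Qed.

End Solutions.

Unset Implicit Arguments.

Theorem theorem2p2 (R : realType) (g rhop rhom mup mum B : R) :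
  0 < g -> 0 < rhom -> rhom < rhop -> 0 < mup -> 0 < mum -> B != 0 ->
  (* (i) *)
  (Bc (g * (rhop - rhom)) <= `|B| ->
     forall xi lam psi, 0 < lam ->
       is_solution g rhop rhom mup mum B xi lam psi -> ~ nontrivial psi) /\
  (* (ii) *)
  (`|B| < Bc (g * (rhop - rhom)) ->
     forall xi, xihc (g * (rhop - rhom)) B <= `|xi| ->
     forall lam psi, 0 < lam ->
       is_solution g rhop rhom mup mum B xi lam psi -> ~ nontrivial psi) /\
  (* (iii) *)
  (`|B| < Bc (g * (rhop - rhom)) ->
     exists (Lam : R -> R) (Psi : R -> R -> R),
       forall xi, 0 < `|xi| < xihc (g * (rhop - rhom)) B ->
         0 < Lam xi /\
         is_solution g rhop rhom mup mum B xi (Lam xi) (Psi xi) /\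
         Lam (- xi) = Lam xi /\
         (forall x, -1 <= x <= 1 -> Psi (- xi) x = Psi xi x) /\
         smooth_open (Psi xi) (-1) 0 /\ smooth_open (Psi xi) 0 1 /\
         Psi xi 0 != 0).
Proof.
move=> g0 rhom0 rho_lt mup0 mum0 B0.
have grho0 : 0 < g * (rhop - rhom) by rewrite mulr_gt0// subr_gt0.
have [rho_le [mup_ge0 mum_ge0]] := (ltW rho_lt, (ltW mup0, ltW mum0)).
split; [|split] => [supercritical xi lam psi lam0|_ xi xi_ge lam psi lam0|_].
- apply: energy_bound_trivial => // dpsi H.
  apply: le_trans (Bc_energy_ge grho0 supercritical H) _.
  rewrite ler_wpM2l ?sqr_ge0// lerDr; exact: mulr_ge0 (sqr_ge0 xi) (L2sq_ge0 psi).
- by apply: energy_bound_trivial => // dpsi H; exact: xihc_energy_ge.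
pose growing k (p : R * (R -> R)) := 0 < k < xihc (g * (rhop - rhom)) B ->
  [/\ 0 < p.1, is_solution g rhop rhom mup mum B k p.1 p.2,
    smooth_open p.2 (-1) 0, smooth_open p.2 0 1 & p.2 0 != 0].
have growing_ex k : exists p, growing k p.
  have [/andP[k0 k_lt]|k_out] := boolP (0 < k < xihc (g * (rhop - rhom)) B).
    have [lam [psi mode]] := exists_growing_mode rhom0 rho_lt mup0 mum0 B0 k0 erefl k_lt.
    by exists (lam, psi).
  by exists (0, fun=> 0); rewrite /growing (negPf k_out).
have [mode modeP] := choice growing_ex.
exists (fun xi => (mode `|xi|).1), (fun xi => (mode `|xi|).2) => xi xi_in.
have [lam0 /is_solution_norm sol smooth_l smooth_r psi0] := modeP _ xi_in.
by rewrite normrN; do 6 (split; first by []); exact: psi0.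
Qed.
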